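(* Let $0<\alpha<1$. Let $\gamma\in C^1(\mathbb{R}^+)$ be a real-valued function that is monotonic on $\mathbb{R}^+$, with $\lim_{t\to0^+}\gamma(t)=0$, such that there exist positive constants $C^{(1)}_1$ and $C^{(1)}_2$ with $C^{(1)}_1\le\left|\frac{t\gamma'(t)}{\gamma(t)}\right|\le C^{(1)}_2$ for all $t\in\mathbb{R}^+$. Assume $\omega_{0,2}\le\omega_{\infty,1}$. (i) Let $1<p<q<\infty$ satisfy $$\frac1p-\frac1q=\frac{\alpha}{M}\quad\text{with } M\in(\omega_{0,2},\omega_{\infty,1}).$$ Then there exists a positive constant $C$ such that for all $f\in L^p(\mathbb{R})$, $$\|I_{\alpha,\gamma}f\|_{L^q(\mathbb{R})}\le C\|f\|_{L^p(\mathbb{R})}.$$ (ii) Conversely, suppose that $1<p<q<\infty$ are such that there exists a positive constant $C$ with $\|I_{\alpha,\gamma}f\|_{L^q(\mathbb{R})}\le C\|f\|_{L^p(\mathbb{R})}$ for all $f\in L^p(\mathbb{R})$. Then $p$ and $q$ satisfy $$\frac1p-\frac1q=\frac{\alpha}{N}\quad\text{with } N\in[\omega_{0,1},\omega_{\infty,2}].$$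
   Context: $\mathbb{R}^+=(0,\infty)$. For $0<\alpha<1$, the fractional integral operator along the curve $(t,\gamma(t))$ is $$I_{\alpha,\gamma}f(x):=\int_0^\infty|f(x-\gamma(t))|\,\frac{dt}{t^{1-\alpha}},\qquad x\in\mathbb{R}.$$ The indices of $\gamma$ are $$\omega_{0,1}:=\liminf_{t\to0^+}\frac{\ln|\gamma(t)|}{\ln t},\quad \omega_{0,2}:=\limsup_{t\to0^+}\frac{\ln|\gamma(t)|}{\ln t},\quad \omega_{\infty,1}:=\liminf_{t\to\infty}\frac{\ln|\gamma(t)|}{\ln t},\quad \omega_{\infty,2}:=\limsup_{t\to\infty}\frac{\ln|\gamma(t)|}{\ln t}.$$ If $\omega_{0,2}=\omega_{\infty,1}$ the interval $(\omega_{0,2},\omega_{\infty,1})$ is empty and part (i) is vacuous. *)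

(* Defs.v *)
From mathcomp Require Import all_boot all_order all_algebra.
From mathcomp Require Import all_classical all_reals all_analysis.
Import Order.TTheory GRing.Theory Num.Theory.
Import numFieldNormedType.Exports.

Set Implicit Arguments.
Unset Strict Implicit.
Unset Printing Implicit Defensive.

Local Open Scope classical_set_scope.
Local Open Scope ring_scope.

(* Functions on (0, +oo) are represented by total functions R -> R whose values
   on (-oo, 0] are never used. *)

Definition continuously_differentiable_pos (R : realType) (gamma : R -> R) : Prop :=
  (forall t : R, 0 < t -> derivable gamma t 1) /\
  (forall t : R, 0 < t -> {for t, continuous (derive1 gamma)}).

Definition monotonic_pos (R : realType) (gamma : R -> R) : Prop :=
  {in `]0, +oo[ &, {homo gamma : s t / s <= t}} \/
  {in `]0, +oo[ &, {homo gamma : s t /~ s <= t}}.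

(* Valued in \bar R: the integral may diverge at some points x. *)
Definition fractional_integral (R : realType) (alpha : R) (gamma f : R -> R) (x : R)
    : \bar R :=
  \int[@lebesgue_measure R]_(t in `]0, +oo[)
    (`|f (x - gamma t)| / t `^ (1 - alpha))%:E.

Definition log_ratio (R : realType) (gamma : R -> R) (t : R) : \bar R :=
  (ln `|gamma t| / ln t)%:E.

Definition omega01 (R : realType) (gamma : R -> R) : \bar R :=
  limf_einf (log_ratio gamma) 0^'+.

Definition omega02 (R : realType) (gamma : R -> R) : \bar R :=
  limf_esup (log_ratio gamma) 0^'+.

Definition omegaoo1 (R : realType) (gamma : R -> R) : \bar R :=
  limf_einf (log_ratio gamma) +oo.

Definition omegaoo2 (R : realType) (gamma : R -> R) : \bar R :=
  limf_esup (log_ratio gamma) +oo.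

(* f ranges over the (Borel) measurable representatives of elements of L^p. Both
   norms depend only on |f|, so real-valued f suffice for complex-valued ones. *)
Definition fractional_integral_bounded (R : realType) (alpha : R) (gamma : R -> R)
    (p q : R) : Prop :=
  exists2 C : R, 0 < C &
    forall f : R -> R, f \in Lfun (@lebesgue_measure R) p%:E ->
      ('N[@lebesgue_measure R]_(q%:E)[fractional_integral alpha gamma f]
        <= C%:E * 'N[@lebesgue_measure R]_(p%:E)[EFin \o f])%E.

(* Main.v *)
From HB Require Import structures.
Require Import Defs.
From mathcomp Require Import all_boot all_order all_algebra.
From mathcomp Require Import all_classical all_reals all_analysis.
From mathcomp Require Import measurable_realfun ring lra.
Import Order.TTheory GRing.Theory Num.Theory.
Import numFieldNormedType.Exports.

(** Write [g := |gamma|].  The growth condition makes [g] vanish nowhere, so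
    [gamma] has a constant sign and [g] is nondecreasing.

    Sufficiency.  The indices at [0] and at [+oo] say that [g t >= t^M] for [t]
    small and for [t] large; by monotonicity [g t >= c * t^M] for all [t > 0]
    ([power_lower_bound]).  Substituting [y = x - gamma t] and bounding
    [t^(alpha - 1)] by [t^alpha * |gamma' t| / (C1 * g t)], the operator is
    dominated pointwise by the Riesz potential of order
    [b = alpha / M = 1/p - 1/q]:
      [I f x <= K * \int |f y| * |x - y|^(b - 1) dy]
    ([fractional_integral_le_riesz]).  Only one inequality in the change of
    variables is needed; it holds for measurable integrands because the image
    under [gamma] of the measure with density [|gamma'|] gives an interval at
    most its length, hence is below the Lebesgue measure
    ([monotone_change_of_variables_le]).

    It remains to bound the Riesz potential from [L^p] to [L^q]
    ([hardy_littlewood_sobolev]), by Hedberg's argument.  Writing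
    [|x - y|^(b - 1)] as a superposition of indicators of balls, the potential
      at [x] is an
    integral over radii [l] of [l^(b - 2)] times the mass of [|f|] in
    [ball x l].  That mass is at most [2 l] times the maximal function [M f x],
    and by Hoelder's inequality at most [(2 l)^(1 - 1/p)] times the [L^p] norm
    [n]; using the former for [l < d] and the latter for [l >= d] gives
    [c * (d^b * M f x + d^(-1/q) * n)] for every [d > 0]
    ([riesz_potential_split]).  Balancing the two terms yields a multiple of
    [n^(1 - p/q) * (M f x)^(p/q)], whose [L^q] norm is controlled by the strong
    type [(p, p)] of the maximal function.  The latter is deduced from the weak
    type [(1, 1)] by truncating [f] at each level and integrating over levels
    ([HL_maximal_strong_type]).

    Necessity.  Test the inequality on the indicator of [[-2 g(t), 2 g(t)]]: for
    [|x| <= g(t)] the points [x - gamma u] with [u <= t] stay in that interval,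
    so [I f x >= t^alpha / 2].  Comparing norms gives
    [c * t^alpha <= g(t)^(1/p - 1/q)] for all [t]
    ([bounded_power_lower_bound]), that is [g t >= c' * t^N] with
    [N = alpha / (1/p - 1/q)].  Taking logarithms near [0] and near [+oo]
    places [N] between the two extreme indices. *)

Set Implicit Arguments.
Unset Strict Implicit.
Unset Printing Implicit Defensive.

Local Open Scope classical_set_scope.
Local Open Scope ring_scope.

(** * Change of variables as an inequality *)

Section weighted_image.
Context (R : realType).
Notation mu := (@lebesgue_measure R).
Variables (D : set R) (w G : R -> R).
Hypotheses (mD : measurable D) (mw : measurable_fun D w).
Hypothesis mG : measurable_fun D G.
Hypothesis w0 : forall t, D t -> 0 <= w t.
Local Open Scope ereal_scope.

(** The image under [G] of the measure on [D] with density [w]. *)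
Definition weighted_image (A : set (measurableTypeR R)) : \bar R :=
  \int[mu]_(t in D `&` G @^-1` A) (w t)%:E.

Let weighted_image0 : weighted_image set0 = 0.
Proof. by rewrite /weighted_image preimage_set0 setI0 integral_set0. Qed.

Let weighted_image_ge0 A : 0 <= weighted_image A.
Proof. by apply: integral_ge0 => t [Dt _]; rewrite lee_fin w0. Qed.

Let weighted_image_sigma_additive : semi_sigma_additive weighted_image.
Proof.
move=> /= F mF tF mUF; rewrite /weighted_image.
have mDF k : measurable (D `&` G @^-1` F k).
  exact: (mG mD (mF k)).
apply: cvg_toP.
  apply: ereal_nondecreasing_is_cvgn => m n mn.
  by apply: lee_sum_nneg_natr => // k _ _; apply: weighted_image_ge0.
rewrite preimage_bigcup setI_bigcupr ge0_integral_bigcup//=.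
- apply/measurable_EFinP; apply: measurable_funS mw => //.
  by move=> t [k _ []].
- by move=> t [k _ [Dt _]]; rewrite lee_fin w0.
- apply/trivIsetP => i j _ _ ij; rewrite setIACA setIid -preimage_setI.
  by move/trivIsetP : tF => ->//; rewrite preimage_set0 setI0.
Qed.

HB.instance Definition _ := isMeasure.Build _ _ _ weighted_image
  weighted_image0 weighted_image_ge0 weighted_image_sigma_additive.

Hypothesis le_itv : forall c d : R, (c < d)%R ->
  weighted_image `]c, d] <= (d - c)%:E.

(** The Lebesgue measure of [A] is the infimum of the total length of countable
    covers of [A] by half-open intervals, so a measure that is at most the
    length on these intervals is below it by countable subadditivity. *)
Lemma weighted_image_le_lebesgue (A : set (measurableTypeR R)) : measurable A ->
  weighted_image A <= mu A.
Proof.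
move=> mA; apply: le_ereal_inf_tmp => _ [F [oF AF] <-].
have mF k : measurable (F k : set (measurableTypeR R)).
  by apply: sub_sigma_algebra; exact: oF.
apply: (le_trans (@measure_sigma_subadditive _ _ _ weighted_image A F mF mA AF))
  => //.
apply: lee_nneseries => // k _.
have /ocitvP[->|[[c d] /= cd ->]] : ocitv (F k) by exact: oF.
  by rewrite measure0.
by rewrite wlength_itv_bnd ?(ltW cd)//=; exact: le_itv.
Qed.

Import HBNNSimple.

(** Both sides are increasing limits over simple functions below [F], and for
    simple functions the inequality is the comparison of the two measures. *)
Lemma weighted_change_of_variables_le (F : R -> \bar R) :
  measurable_fun setT F -> (forall y, 0 <= F y) ->
  \int[mu]_(t in D) (F (G t) * (w t)%:E) <= \int[mu]_y F y.
Proof.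
move=> mF F0.
pose h := nnsfun_approx measurableT mF.
have le_indic (A : set R) : measurable A ->
    weighted_image A <= \int[mu]_y (\1_A y)%:E.
  move=> mA; rewrite integral_indic// setIT.
  exact: weighted_image_le_lebesgue.
have nnsfun_le n : \int[mu]_(t in D) ((h n (G t))%:E * (w t)%:E) <=
    \int[mu]_y (h n y)%:E.
  have hE y : (h n y)%:E =
      \sum_(k \in range (h n)) k%:E * (\1_(h n @^-1` [set k]) y)%:E.
    by rewrite fsumEFin//= fimfunE.
  have mhG k : measurable (D `&` G @^-1` (h n @^-1` [set k])).
    by apply: (mG mD); exact: measurable_sfunP.
  have mind k : measurable_fun setT (\1_(h n @^-1` [set k]) : R -> R).
    by apply: measurable_indic; exact: measurable_sfunP.
  have mwk k :
      measurable_fun D (fun t => (\1_(h n @^-1` [set k]) (G t) * w t)%R).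
    apply: measurable_funM => //.
    exact: (measurableT_comp (mind k) mG).
  have -> : \int[mu]_(t in D) ((h n (G t))%:E * (w t)%:E) =
     \sum_(k \in range (h n)) k%:E * weighted_image (h n @^-1` [set k]).
    transitivity (\int[mu]_(t in D) \sum_(k \in range (h n))
        k%:E * (\1_(h n @^-1` [set k]) (G t) * w t)%:E).
      apply: eq_integral => t Dt; rewrite hE ge0_mule_fsuml//; last first.
        by move=> k; rewrite nnfun_muleindic_ge0.
      by apply: eq_fsbigr => k _; rewrite EFinM muleA.
    rewrite ge0_integral_fsum//; last 2 first.
    - move=> k; apply/measurable_EFinP.
      exact: (measurable_funM _ (mwk k)).
    - move=> k t Dt; rewrite EFinM muleA mule_ge0 // ?lee_fin ?w0//.
      exact: nnfun_muleindic_ge0.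
    apply: eq_fsbigr => k; rewrite inE => -[y _ <-].
    rewrite ge0_integralZl//; last 3 first.
      apply/measurable_EFinP; exact: mwk.
    - by move=> t Dt; rewrite lee_fin mulr_ge0 ?w0.
    - by rewrite lee_fin.
    congr (_ * _); rewrite /weighted_image [RHS]integral_mkcondr.
    apply: eq_integral => t _; rewrite patchE indicE.
    have -> : (t \in G @^-1` (h n @^-1` [set h n y])) =
        (G t \in h n @^-1` [set h n y]) by apply/idP/idP; rewrite !inE.
    by case: ifPn => _; rewrite ?mul1r ?mul0r.
  under [leRHS]eq_integral do rewrite hE.
  rewrite ge0_integral_fsum//; last 2 first.
  - by move=> k; apply/measurable_EFinP; exact: (measurable_funM _ (mind k)).
  - by move=> k y _; exact: nnfun_muleindic_ge0.
  apply: lee_fsum => // k [y _ <-].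
  rewrite ge0_integralZl ?lee_fin//; last by apply/measurable_EFinP;
    exact: mind.
  apply: lee_wpmul2l; rewrite ?lee_fin//.
  by apply: le_indic; exact: measurable_sfunP.
have mhn n : measurable_fun setT (fun y =>
  (h n y)%:E) by exact/measurable_EFinP.
have cvF y : (h n y)%:E @[n --> \oo] --> F y by exact: cvg_nnsfun_approx.
have ndh y : nondecreasing_seq (fun n => (h n y)%:E).
  by move=> m n mn; rewrite lee_fin; exact/lefP/nd_nnsfun_approx.
rewrite [leRHS](_ : _ = limn (fun n => \int[mu]_y (h n y)%:E)); last first.
  rewrite -monotone_convergence//.
    by apply: eq_integral => y _; apply/esym/cvg_lim => //; exact: cvF.
  by move=> n y _; rewrite lee_fin.
rewrite [leLHS](_ : _ = limn (fun n =>
    \int[mu]_(t in D) ((h n (G t))%:E * (w t)%:E))); last first.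
  rewrite -monotone_convergence//.
  - apply: eq_integral => t _; apply/esym/cvg_lim => //.
    by apply: cvgeZr => //; exact: cvF.
  - move=> n; apply: emeasurable_funM; last exact/measurable_EFinP.
    exact: (measurableT_comp (mhn n) mG).
  - by move=> n t Dt; rewrite mule_ge0 ?lee_fin ?w0.
  - by move=> t Dt m n mn; rewrite lee_wpmul2r ?lee_fin ?w0//; exact: ndh.
apply: lee_lim.
- apply: ereal_nondecreasing_is_cvgn => m n mn; apply: ge0_le_integral => //.
  + by move=> t Dt; rewrite mule_ge0 ?lee_fin ?w0.
  + apply: emeasurable_funM; last exact/measurable_EFinP.
    exact: (measurableT_comp (mhn m) mG).
  + apply: emeasurable_funM; last exact/measurable_EFinP.
    exact: (measurableT_comp (mhn n) mG).
  + by move=> t Dt; rewrite lee_wpmul2r ?lee_fin ?w0//; exact: ndh.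
- apply: ereal_nondecreasing_is_cvgn => m n mn.
  apply: (ge0_le_integral mu measurableT _ (mhn m) (mhn n)) => y _.
    by rewrite lee_fin.
  exact: ndh.
- exact: nearW.
Qed.
End weighted_image.

Lemma integral_derivative_itv (R : realType) (F w : R -> R) (a b : R) :
    0 < a -> a <= b -> (forall t : R, 0 < t -> is_derive t 1 F (w t)) ->
    (forall t : R, 0 < t -> {for t, continuous w}) ->
  (\int[@lebesgue_measure R]_(t in `[a, b]) (w t)%:E = (F b - F a)%:E)%E.
Proof.
move=> a0 ab dF cw.
have cF (t : R) : 0 < t -> {for t, continuous F}.
  by move=> t0; apply/differentiable_continuous/derivable1_diffP; have [] :=
    dF t t0.
move: ab; rewrite le_eqVlt => /predU1P[<-|ab].
  by rewrite set_itv1 integral_set1 subrr.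
rewrite (@continuous_FTC2 _ w F) ?EFinB//.
- apply: continuous_in_subspaceT => t; rewrite inE/= in_itv/= => /andP[+ _].
  by move=> /(lt_le_trans a0); exact: cw.
- split.
  + move=> t; rewrite in_itv/= => /andP[+ _] => /(lt_trans a0) t0.
    by have [] := dF t t0.
  + by apply: cvg_at_right_filter; exact: cF.
  + by apply: cvg_at_left_filter; apply: cF; exact: lt_trans ab.
- move=> t; rewrite in_itv/= => /andP[+ _] => /(lt_trans a0) t0.
  by have [_ <-] := dF t t0; rewrite derive1E.
Qed.

(** One half of the substitution rule, with [s = 1] for increasing and [s = -1]
    for decreasing [G]; [w] is the absolute value of its derivative. On a
    compact subinterval of the half-line the points sent into [[c, d]] lie
    between the smallest and the largest of them, [a] and [b], so by the
    fundamental theorem of calculus the integral of [w] over them is at most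
    [|G b - G a| <= d - c]. *)
Lemma monotone_change_of_variables_le (R : realType) (G w : R -> R) (s : R)
    (F : R -> \bar R) :
    `|s| = 1 -> (forall t : R, 0 < t -> is_derive t 1 G (s * w t)) ->
    (forall t : R, 0 < t -> 0 <= w t) -> (forall t : R, 0 < t ->
      {for t, continuous w}) ->
    measurable_fun setT F -> (forall y, 0 <= F y)%E ->
  (\int[@lebesgue_measure R]_(t in `]0%R, +oo[) (F (G t) * (w t)%:E)
    <= \int[@lebesgue_measure R]_y F y)%E.
Proof.
move=> s1 dG w0 cw mF F0.
have ss : s * s = 1 by rewrite -expr2 -real_normK ?num_real// s1 expr1n.
have dsG (t : R) : 0 < t -> is_derive t 1 (fun u => s * G u) (w t).
  move=> t0; have := is_deriveZ s (dG t t0).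
  by rewrite /GRing.scale/= mulrA ss mul1r.
have cG (t : R) : 0 < t -> {for t, continuous G}.
  by move=> t0; apply/differentiable_continuous/derivable1_diffP; have [] :=
    dG t t0.
have mw : measurable_fun (`]0%R, +oo[ : set R) w.
  apply: open_continuous_measurable_fun; first exact: interval_open.
  by move=> t; rewrite inE/= in_itv/= andbT; exact: cw.
have mG : measurable_fun (`]0%R, +oo[ : set R) G.
  apply: open_continuous_measurable_fun; first exact: interval_open.
  by move=> t; rewrite inE/= in_itv/= andbT; exact: cG.
apply: weighted_change_of_variables_le => //.
  by move=> t; rewrite /= in_itv/= andbT; exact: w0.
move=> c d cd; rewrite /weighted_image.
pose E n : set R := `[n.+1%:R^-1, n.+1%:R] `&` G @^-1` `]c, d].
have E0 n t : E n t -> 0 < t.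
  by move=> -[/=]; rewrite in_itv/= => /andP[+ _] _; apply: lt_le_trans.
have mE n : measurable (E n).
  rewrite (_ : E n = `[n.+1%:R^-1, n.+1%:R] `&` (`]0, +oo[ `&` G @^-1` `]c,
    d])).
    by apply: measurableI => //; exact: mG.
  apply/seteqP; split => t; last by move=> [? []].
  by move=> Et; have [tn Gt] := Et; split=> //; split => //=;
    rewrite in_itv/= (E0 n).
(* The compact intervals [1/(n+1), n+1] exhaust the half-line. *)
have -> : `]0, +oo[ `&` G @^-1` `]c, d] = \bigcup_n E n.
  apply/seteqP; split => [t /= []|t [n _ Et]]; last first.
    by split; [rewrite /= in_itv/= (E0 n)|have [] := Et].
  rewrite in_itv/= andbT => t0 Gt.
  have [n /andP[nt tn]] : exists n, (t^-1 <= n.+1%:R) && (t <= n.+1%:R).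
    exists (Num.truncn (Num.max t t^-1)).
    have := truncnS_gt (Num.max t t^-1); rewrite gt_max => /andP[/ltW-> /ltW->].
    by [].
  exists n => //; split => //=; rewrite in_itv/= tn andbT.
  by rewrite -[leRHS]invrK lef_pV2// posrE ?invr_gt0.
have ndE : nondecreasing_seq E.
  apply/nondecreasing_seqP => n; apply/subsetPset => t [/= tn Gt]; split => //=.
  move: tn; rewrite !in_itv/= => /andP[nt tn].
  rewrite (le_trans _ nt) ?(le_trans tn) ?ler_nat//.
  by rewrite lef_pV2 ?posrE// ler_nat.
have mwE n : measurable_fun (E n) (EFin \o w).
  apply/measurable_EFinP; apply: measurable_funS mw => // t /E0.
  by rewrite /= in_itv/= andbT.
have cvgE := @ge0_nondecreasing_set_cvg_integral _ (measurableTypeR R) R E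
  (EFin \o w) (@lebesgue_measure R) ndE mE mwE.
have {}cvgE := cvgE (fun n t Et => w0 t (E0 n t Et)).
rewrite -(cvg_lim _ cvgE)//.
apply: lime_le; first by apply/cvg_ex; eexists; exact: cvgE.
apply: nearW => n.
have [E_0|/set0P[t0 Et0]] := eqVneq (E n) set0.
  by rewrite E_0 integral_set0 lee_fin subr_ge0 ltW.
pose K : set R := `[n.+1%:R^-1, n.+1%:R] `&` G @^-1` `[c, d].
have K0 t : K t -> 0 < t.
  by move=> -[/=]; rewrite in_itv/= => /andP[+ _] _; apply: lt_le_trans.
have cK : compact K.
  have KI : K `<=` `[n.+1%:R^-1, n.+1%:R] by move=> ? [].
  apply: (subclosed_compact _ _ KI).
    have cGI : {within `[n.+1%:R^-1, n.+1%:R], continuous G}.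
      apply: continuous_in_subspaceT => t; rewrite inE/= in_itv/= => /andP[+ _].
      by move=> nt; apply: cG; exact: lt_le_trans nt.
    have [] := (closed_subspaceP (`[n.+1%:R^-1, n.+1%:R]%classic : set R)
      (G @^-1` `[c, d])).1.
      by move/continuous_closedP : cGI; apply; exact: itv_closed.
    move=> V cV; rewrite setIC => VE; rewrite /K setIC -VE setIC.
    by apply: closedI => //; exact: itv_closed.
  exact: segment_compact.
have EK : E n `<=` K.
  move=> t [tn]; rewrite /= in_itv/= => /andP[cG' Gd]; split => //=.
  by rewrite in_itv/= (ltW cG').
have Kn0 : K !=set0 by exists t0; exact: EK.
have cid : {within K, continuous (@idfun R)}.
  by apply: continuous_subspaceT => ?; exact: cvg_id.
have [a /set_mem Ka aK] := compact_EVT_min Kn0 cK cid.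
have [b /set_mem Kb bK] := compact_EVT_max Kn0 cK cid.
have ab : a <= b by apply: aK; exact/mem_set.
apply: (@le_trans _ _ (\int[@lebesgue_measure R]_(t in `[a, b]) (w t)%:E)%E).
  apply: ge0_subset_integral => //.
  - exact: mE.
  - apply/measurable_EFinP; apply: measurable_funS mw => // t /=.
    by rewrite !in_itv/= andbT => /andP[+ _]; apply: lt_le_trans; exact: K0.
  - move=> t /=; rewrite in_itv/= => /andP[+ _] => /(lt_le_trans (K0 _ Ka)).
    by rewrite lee_fin; exact: w0.
  - by move=> t /EK Kt /=; rewrite in_itv/= aK ?bK//; exact/mem_set.
rewrite (@integral_derivative_itv _ _ _ _ _ (K0 _ Ka) ab dsG cw) lee_fin
  -mulrBr.
apply: (le_trans (ler_norm _)); rewrite normrM s1 mul1r.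
have [_ /=] := Ka; have [_ /=] := Kb; rewrite !in_itv/=.
by move=> /andP[? ?] /andP[? ?]; rewrite ler_norml; apply/andP; split; lra.
Qed.

(** The substitution [u = t^s] sends the set of integration into the interval
    from [0] to [r^s]. That set is [t <= r] for [s > 0] and [t >= r] for
    [s < 0], so improper integrals at both ends are covered. *)
Lemma integral_powR_le (R : realType) (s r : R) : s != 0 -> 0 < r ->
  (\int[@lebesgue_measure R]_(t in `]0%R, +oo[)
     ((\1_[set u : R | u `^ s <= r `^ s] t)%:E * (`|s| * t `^ (s - 1))%:E)
    <= (r `^ s)%:E)%E.
Proof.
move=> s0 r0.
pose A : set R := `]0, r `^ s]%classic.
have mA : measurable A by exact: measurable_itv.
have <- : (\int[@lebesgue_measure R]_y (\1_A y)%:E)%E = (r `^ s)%:E.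
  rewrite integral_indic//= setIT /A lebesgue_measure_itv/= lte_fin powR_gt0//.
  by rewrite -EFinB subr0.
apply: le_trans (@monotone_change_of_variables_le R (fun t => t `^ s)
  (fun t => `|s| * t `^ (s - 1)) (Num.sg s)
  (fun y => (\1_A y)%:E) _ _ _ _ _ _).
- rewrite le_eqVlt; apply/orP; left; apply/eqP; apply: eq_integral => t.
  rewrite inE/= in_itv/= andbT => t0; congr (_%:E * _)%E; rewrite !indicE;
    congr (_%:R).
  congr nat_of_bool; apply/idP/idP; rewrite !inE/= /A/= in_itv/= ?powR_gt0//.
- by rewrite normr_sg s0.
- by move=> t t0; rewrite mulrA -numEsg; exact: is_derive1_powR.
- by move=> t t0; rewrite mulr_ge0// powR_ge0.
- move=> t t0; apply: continuousM; first exact: cvg_cst.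
  apply/differentiable_continuous.
  by apply/derivable1_diffP; apply: derivable_powR; rewrite in_itv/= t0.
- by apply/measurable_EFinP; exact: measurable_indic.
- by move=> y; rewrite lee_fin indicE ler0n.
Qed.

(** * Integrals over the half-line *)

Section half_line.
Context (R : realType).
Notation mu := (@lebesgue_measure R).
Notation halfline := (`]0%R, +oo[%classic : set R).

Lemma fubini_tonelli_halfline (h : R * R -> \bar R) :
    measurable_fun setT h -> (forall z, 0 <= h z)%E ->
  (\int[mu]_x \int[mu]_(t in halfline) h (x, t) =
   \int[mu]_(t in halfline) \int[mu]_x h (x, t))%E.
Proof.
move=> mh h0.
pose h' (z : R * R) : \bar R := if 0 < z.2 then h z else 0%E.
have mh' : measurable_fun setT h'.
  apply: measurable_fun_ifT => //.
  by apply: measurable_fun_ltr.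
have h'0 z : (0 <= h' z)%E by rewrite /h'; case: ifPn.
transitivity (\int[mu]_x \int[mu]_t h' (x, t))%E.
  apply: eq_integral => x _; rewrite integral_mkcond; apply: eq_integral => t _.
  by rewrite patchE /h' mem_setE in_itv/= andbT.
rewrite (@fubini_tonelli _ _ _ _ _ mu mu h' mh' h'0) [RHS]integral_mkcond.
apply: eq_integral => t _; rewrite patchE mem_setE in_itv/= andbT.
case: ifPn => t0.
  by apply: eq_integral => x _; rewrite /h' /= t0.
by apply: integral0_eq => x _; rewrite /h' /= (negbTE t0).
Qed.

Lemma measurable_fun_halfline_fubini (h : R * R -> \bar R) :
    measurable_fun setT h -> (forall z, 0 <= h z)%E ->
  measurable_fun setT (fun x => \int[mu]_(t in halfline) h (x, t))%E.
Proof.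
move=> mh h0.
pose h' (z : R * R) : \bar R := if 0 < z.2 then h z else 0%E.
have mh' : measurable_fun setT h'.
  apply: measurable_fun_ifT => //.
  by apply: measurable_fun_ltr.
have h'0 z : (0 <= h' z)%E by rewrite /h'; case: ifPn.
rewrite (_ : (fun x => _) = (fun x => \int[mu]_t h' (x, t))%E).
  exact: (@measurable_fun_fubini_tonelli_F _ _ _ _ _ mu h' mh' h'0).
apply/funext => x; rewrite integral_mkcond; apply: eq_integral => t _.
by rewrite patchE /h' mem_setE in_itv/= andbT.
Qed.

Lemma integral_halfline_powR_le (s r : R) (b : R -> bool) :
    s != 0 -> 0 < r -> measurable_fun setT b ->
    (forall t, 0 < t -> b t -> t `^ s <= r `^ s) ->
  (\int[mu]_(t in halfline) (if b t then (t `^ (s - 1))%:E else 0)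
    <= (r `^ s / `|s|)%:E)%E.
Proof.
move=> s0 r0 mb br.
have s0' : 0 < `|s| by rewrite normr_gt0.
have mif : measurable_fun setT
    (fun t => if b t then (t `^ (s - 1))%:E else 0%E : \bar R).
  apply: measurable_fun_ifT => //.
  by apply/measurable_EFinP; exact: measurable_powR.
rewrite EFinM lee_pdivlMr// muleC -ge0_integralZl//=; last 2 first.
- exact: measurable_funTS.
- by move=> t _; case: ifPn => // _; rewrite lee_fin powR_ge0.
apply: le_trans (integral_powR_le s0 r0).
apply: ge0_le_integral => //=.
- by move=> t _; case: ifPn => // _;
    rewrite ?mule0// mule_ge0 ?lee_fin ?powR_ge0.
- by apply: emeasurable_funM => //; exact: measurable_funTS.
- apply: emeasurable_funM; apply/measurable_EFinP/measurable_funTS; last first.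
    by apply: measurable_funM => //; exact: measurable_powR.
  apply: measurable_indic; rewrite -[X in measurable X]setTI.
  exact: (measurable_fun_ler (measurable_powR s) (measurable_cst _)).
move=> t; rewrite in_itv/= andbT => t0; case: ifPn => bt.
  by rewrite indicE mem_set ?mul1e//=; exact: br.
by rewrite mule0 mule_ge0 ?lee_fin ?mulr_ge0 ?powR_ge0// indicE ler0n.
Qed.

Lemma integral_halfline_ge (h : R -> \bar R) (a b c : R) :
    0 < a -> a <= b -> 0 <= c -> measurable_fun halfline h ->
    (forall t : R, 0 < t -> (0 <= h t)%E) ->
    (forall t : R, a <= t <= b -> (c%:E <= h t)%E) ->
  ((c * (b - a))%:E <= \int[mu]_(t in halfline) h t)%E.
Proof.
move=> a0 ab c0 mh h0 hc.
have abh : `[a, b] `<=` halfline.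
  by move=> t /=; rewrite !in_itv/= andbT => /andP[+ _]; exact: lt_le_trans.
apply: (@le_trans _ _ (\int[mu]_(t in `[a, b]) h t)%E); last first.
  apply: ge0_subset_integral => // t /=.
  by rewrite in_itv/= andbT; exact: h0.
apply: (@le_trans _ _ (\int[mu]_(t in `[a, b]) c%:E)%E); last first.
  apply: ge0_le_integral => //.
  exact: measurable_funS mh.
rewrite integral_cst//= lebesgue_measure_itv/= lte_fin.
case: ltP => [_|ba]; first by rewrite -EFinB -EFinM.
by rewrite mule0 lee_fin mulr_ge0_le0// subr_le0.
Qed.

End half_line.

(** * Strong type of the maximal function *)

Section maximal.
Context (R : realType).
Notation mu := (@lebesgue_measure R).
Notation halfline := (`]0%R, +oo[%classic : set R).
Local Open Scope ereal_scope.

Lemma HL_maximal_le_add (f g : R -> R) (c : R) :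
    measurable_fun setT f -> measurable_fun setT g ->
    (0 <= c)%R -> (forall y, `|g y| <= c)%R ->
  forall x, HL_maximal (f \+ g)%R x <= HL_maximal f x + c%:E.
Proof.
move=> mf mg c0 gc x; apply: ge_ereal_sup => _ [r /= r0 <-].
rewrite in_itv/= andbT in r0.
have mB : measurable (ball x r : set R) by exact: measurable_ball.
have muB := lebesgue_measure_ball x (ltW r0).
have r20 : (0 < r *+ 2)%R by rewrite pmulrn_lgt0.
apply: (@le_trans _ _ (iavg f (ball x r) + iavg g (ball x r))).
  apply: iavgD => //; try exact: measurable_funTS.
    by rewrite [ltRHS]/= muB ltry.
apply: leeD.
  by apply: ereal_sup_ubound => /=; exists r => //; rewrite in_itv/= andbT.
rewrite /iavg muB inver gt_eqF//= lee_pdivrMl//.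
apply: (@le_trans _ _ (\int[mu]_(y in ball x r) c%:E)).
  apply: ge0_le_integral => //.
  - apply/measurable_EFinP/measurableT_comp => //; exact: measurable_funTS.
  - by move=> y _; rewrite lee_fin.
by rewrite integral_cst//= muB -EFinM mulrC.
Qed.

(** The part of [f] of absolute value at most [l / 2] contributes at most
    [l / 2] to the maximal function, so only the rest of [f] matters where the
    maximal function exceeds [l]; apply the weak type [(1, 1)] to the rest at
    level [l / 2]. *)
Lemma HL_maximal_weak_type_truncated (f : R -> R) (l : R) :
    locally_integrable setT f -> (0 < l)%R ->
  mu [set x | l%:E < HL_maximal f x] <=
    (6 / l)%:E * \int[mu]_x (if (l < 2 * `|f x|)%R then `|f x|%:E else 0).
Proof.
move=> lf l0; have [mf _ finf] := lf.
pose big x := if (l < 2 * `|f x|)%R then f x else 0%R.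
pose small x := if (l < 2 * `|f x|)%R then 0%R else f x.
have mb : measurable_fun setT (fun x => (l < 2 * `|f x|)%R).
  by apply: measurable_fun_ltr => //; apply: measurable_funM => //;
    exact: measurableT_comp.
have mbig : measurable_fun setT big by exact: measurable_fun_ifT.
have msmall : measurable_fun setT small by exact: measurable_fun_ifT.
have fE : f = (big \+ small)%R.
  by apply/funext => x; rewrite /big /small /=; case: ifPn;
    rewrite ?addr0 ?add0r.
have lbig : locally_integrable setT big.
  split; [exact: mbig|exact: openT|move=> K KT cK].
  apply: le_lt_trans (finf K KT cK).
  apply: ge0_le_integral => //.
  - exact: compact_measurable.
  - by apply/measurable_EFinP/measurableT_comp => //; exact: measurable_funTS.
  - by apply/measurable_EFinP/measurableT_comp => //; exact: measurable_funTS.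
  - by move=> x _; rewrite /big; case: ifPn; rewrite ?normr0 lee_fin.
have l20 : (0 < l / 2)%R by rewrite divr_gt0.
apply: (@le_trans _ _ (mu [set x | (l / 2)%:E < HL_maximal big x])).
  apply: le_measure; rewrite ?inE.
  - rewrite -[X in measurable X]setTI; apply: emeasurable_fun_o_infty => //.
    exact: measurable_HL_maximal.
  - rewrite -[X in measurable X]setTI; apply: emeasurable_fun_o_infty => //.
    exact: measurable_HL_maximal.
  - move=> x /= lx.
    have : HL_maximal f x <= HL_maximal big x + (l / 2)%:E.
      rewrite [in leLHS]fE; apply: HL_maximal_le_add => // [|y];
        first exact: ltW.
      rewrite /small; case: ifPn; first by rewrite normr0 ltW.
      by rewrite -leNgt ler_pdivlMr// mulrC.
    by move/(lt_le_trans lx); rewrite {1}(splitr l) EFinD lteD2rE.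
apply: le_trans (maximal_inequality lbig l20) _.
rewrite invf_div mulrA -natrM; apply: lee_wpmul2l => //.
  by rewrite lee_fin divr_ge0// ltW.
rewrite le_eqVlt; apply/orP; left; apply/eqP.
by apply: eq_integral => x _; rewrite /= /big; case: ifPn => // _;
  rewrite normr0.
Qed.

(** A layer-cake bound of [m^p]. The constant is not sharp: for every finite
    [r <= m] the levels between [r / 4] and [r / 2] already contribute at least
    [(r / 4)^p], which also covers [m = +oo]. *)
Lemma poweR_le_layers (p : R) (m : \bar R) : (1 <= p)%R -> 0 <= m ->
  m `^ p <= (4 `^ p)%:E *
    \int[mu]_(l in halfline) (if l%:E < m then (l `^ (p - 1))%:E else 0).
Proof.
move=> p1 m0; have p0 : (0 < p)%R by exact: lt_le_trans p1.
set J := \int[mu]_(l in halfline) _.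
have J0 : 0 <= J by apply: integral_ge0 => l _; case: ifPn => // _;
  rewrite lee_fin powR_ge0.
have core (r : R) : (0 < r)%R -> (forall l : R, (l <= r / 2)%R -> l%:E < m) ->
    (r `^ p)%:E <= (4 `^ p)%:E * J.
  move=> r0 rm.
  have -> : (r `^ p = 4 `^ p * ((r / 4) `^ (p - 1) * (r / 2 - r / 4)))%R.
    have -> : (r / 2 - r / 4 = r / 4)%R by lra.
    rewrite mulrC [X in (_ = X * _)%R]mulrC mulr_powRB1 ?divr_ge0 ?ltW//.
    rewrite -powRM ?divr_ge0 ?ltW//; congr (_ `^ _)%R; lra.
  rewrite EFinM lee_wpmul2l ?lee_fin ?powR_ge0//.
  apply: integral_halfline_ge; rewrite ?powR_ge0//.
  - by rewrite divr_gt0.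
  - by lra.
  - apply: measurable_funTS; apply: measurable_fun_ifT => //.
      by apply: measurable_fun_lte => //; exact: measurable_cst.
    by apply/measurable_EFinP; exact: measurable_powR.
  - by move=> l _; case: ifPn => // _; rewrite lee_fin powR_ge0.
  - move=> l /andP[rl lr];
      rewrite rm// lee_fin ge0_ler_powR ?nnegrE ?subr_ge0//.
      by rewrite divr_ge0// ltW.
    by rewrite (le_trans _ rl)// divr_ge0// ltW.
have J40 : 0 <= (4 `^ p)%:E * J by rewrite mule_ge0// lee_fin powR_ge0.
case: m m0 @J J0 core J40 => [r| |//] m0 J J0 core J40.
  rewrite poweR_EFin; move: m0; rewrite lee_fin le_eqVlt => /predU1P[<-|r0].
    by rewrite powR0 ?gt_eqF.
  by apply: core => // l lr; rewrite lte_fin; lra.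
rewrite poweRyr ?gt_eqF// leye_eq; apply/eqP/eqyP => A A0.
have AE : ((A `^ p^-1) `^ p = A)%R.
  by rewrite -powRrM mulVf ?gt_eqF// powRr1// ltW.
rewrite -[in leLHS]AE; apply: core.
  exact: powR_gt0.
by move=> l _; rewrite ltry.
Qed.

Lemma integral_if_cst (A : set R) (c : R) : measurable A -> (0 <= c)%R ->
  \int[mu]_x (if x \in A then c%:E else 0) = c%:E * mu A.
Proof.
move=> mA c0; rewrite -integral_cst// [RHS]integral_mkcond.
by apply: eq_integral => x _; rewrite patchE.
Qed.

(** Marcinkiewicz interpolation between weak type [(1, 1)] and [L^oo]: integrate
    the truncated weak type estimate against [l^(p - 1)] over the levels [l] and
    exchange the integrals; what is left for each [x] is [|f x|] times the
    integral of [l^(p - 2)] over [l < 2 |f x|]. *)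
Lemma HL_maximal_strong_type (p : R) : (1 < p)%R ->
  exists2 C : R, (0 < C)%R & forall f : R -> R, locally_integrable setT f ->
    \int[mu]_x (HL_maximal f x `^ p) <= C%:E * \int[mu]_x (`|f x| `^ p)%:E.
Proof.
move=> p1; have p0 : (0 < p)%R by exact: lt_trans p1.
have p10 : (0 < p - 1)%R by rewrite subr_gt0.
(* 4^p comes from the layers, 6 from the weak type at level l / 2, and the rest
   from the integral of l^(p - 2) over l < 2 |f x|. *)
exists (4 `^ p * (6 * (2 `^ (p - 1) / (p - 1))))%R.
  by rewrite !mulr_gt0 ?invr_gt0 ?powR_gt0.
move=> f lf; have [mf _ _] := lf.
have mM : measurable_fun setT (HL_maximal f) by exact: measurable_HL_maximal.
have M0 x : 0 <= HL_maximal f x by exact: HL_maximalT_ge0.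
pose h (z : R * R) : \bar R :=
  if z.2%:E < HL_maximal f z.1 then (z.2 `^ (p - 1))%:E else 0.
have h0 z : 0 <= h z by rewrite /h; case: ifPn => // _;
  rewrite lee_fin powR_ge0.
have mh : measurable_fun setT h.
  apply: measurable_fun_ifT => //.
    apply: measurable_fun_lte.
      by apply/measurable_EFinP; exact: measurable_snd.
    by apply: (measurableT_comp mM); exact: measurable_fst.
  by apply/measurable_EFinP; apply: (measurableT_comp (measurable_powR _)).
pose k (z : R * R) : \bar R :=
  if (z.2 < 2 * `|f z.1|)%R then (z.2 `^ (p - 1 - 1) * `|f z.1|)%:E else 0.
have k0 z : 0 <= k z.
  by rewrite /k; case: ifPn => // _; rewrite lee_fin mulr_ge0// powR_ge0.
have mf1 : measurable_fun setT (fun z : R * R => `|f z.1|%R).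
  by apply: measurableT_comp => //; exact: (measurableT_comp mf).
have mk : measurable_fun setT k.
  apply: measurable_fun_ifT => //.
    by apply: measurable_fun_ltr => //; exact: measurable_funM.
  apply/measurable_EFinP; apply: measurable_funM => //.
  exact: (measurableT_comp (measurable_powR _)).
have mG (g : R * R -> \bar R) : measurable_fun setT g -> (forall z, 0 <= g z) ->
    measurable_fun setT (fun t => \int[mu]_x g (x, t)).
  by move=> mg g0; exact: (@measurable_fun_fubini_tonelli_G _ _ _ _ _ mu g mg
    g0).
apply: (@le_trans _ _ (\int[mu]_x ((4 `^ p)%:E * \int[mu]_(l in halfline) h (x,
  l)))).
  apply: ge0_le_integral => //.
  - by move=> x _; exact: poweR_ge0.
  - exact: (measurableT_comp (measurable_poweR _)).
  - by apply: emeasurable_funM => //; exact: measurable_fun_halfline_fubini.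
  - by move=> x _; apply: poweR_le_layers => //; exact: ltW.
rewrite ge0_integralZl//; last 2 first.
- exact: measurable_fun_halfline_fubini.
- by move=> x _; exact: integral_ge0.
rewrite EFinM -muleA; apply: lee_wpmul2l; first by rewrite lee_fin powR_ge0.
rewrite fubini_tonelli_halfline//.
apply: (@le_trans _ _ (\int[mu]_(l in halfline) (6%:E * \int[mu]_x k (x, l)))).
  apply: ge0_le_integral => //.
  - by move=> l _; exact: integral_ge0.
  - apply: measurable_funTS; exact: (mG h mh h0).
  - apply: emeasurable_funM; first exact: measurable_cst.
    apply: measurable_funTS; exact: (mG k mk k0).
  suff layer (l : R) : (0 < l)%R ->
      \int[mu]_x h (x, l) <= 6%:E * \int[mu]_x k (x, l).
    by move=> l; rewrite /= in_itv/= andbT; exact: layer.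
  move=> l0.
  have mlM : measurable [set x | l%:E < HL_maximal f x].
    by rewrite -[X in measurable X]setTI; exact: emeasurable_fun_o_infty.
  have mb : measurable_fun setT (fun x => (l < 2 * `|f x|)%R).
    by apply: measurable_fun_ltr => //; apply: measurable_funM => //;
      exact: measurableT_comp.
  under eq_integral => x _.
    rewrite /h /= (_ : (l%:E < _) = (x \in [set x | l%:E < HL_maximal f x]));
      last first.
      by apply/idP/idP; rewrite inE.
    over.
  rewrite (integral_if_cst mlM) ?powR_ge0//.
  apply: le_trans (lee_wpmul2l _ (HL_maximal_weak_type_truncated lf l0)) _.
    by rewrite lee_fin powR_ge0.
  rewrite muleA -EFinM.
  have -> : (l `^ (p - 1) * (6 / l) = 6 * l `^ (p - 1 - 1))%R.
    rewrite -[in LHS](@mulr_powRB1 _ l (p - 1)%R) ?ltW//.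
    by field; exact: lt0r_neq0.
  rewrite EFinM -muleA; apply: lee_wpmul2l => //.
  rewrite -ge0_integralZl//.
  - rewrite le_eqVlt; apply/orP; left; apply/eqP; apply: eq_integral => x _.
    by rewrite /k/=; case: ifPn => _; rewrite ?mule0// EFinM.
  - apply: measurable_fun_ifT => //.
    by apply/measurable_EFinP; exact: measurableT_comp.
  - by move=> x _; case: ifPn => // _; rewrite lee_fin.
  - by rewrite lee_fin powR_ge0.
rewrite ge0_integralZl//; last 2 first.
- apply: measurable_funTS; exact: (mG k mk k0).
- by move=> l _; exact: integral_ge0.
rewrite EFinM -muleA; apply: lee_wpmul2l => //.
rewrite -fubini_tonelli_halfline//.
rewrite -ge0_integralZl//; last 2 first.
- apply/measurable_EFinP; apply: (measurableT_comp (measurable_powR p)).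
  exact: measurableT_comp.
- by rewrite lee_fin divr_ge0 ?powR_ge0// ltW.
apply: ge0_le_integral => //.
- by move=> x _; exact: integral_ge0.
- exact: measurable_fun_halfline_fubini.
- apply: emeasurable_funM => //.
  apply/measurable_EFinP; apply: (measurableT_comp (measurable_powR p)).
  exact: measurableT_comp.
move=> x _; rewrite /k /=.
have [fx0|fx0] := eqVneq (f x) 0%R.
  rewrite integral0_eq;
    first by rewrite mule_ge0 ?lee_fin ?powR_ge0// divr_ge0 ?powR_ge0// ltW.
  by move=> l; rewrite /= in_itv/= andbT fx0 normr0 mulr0 => l0;
    rewrite ltNge ltW.
have a0 : (0 < `|f x|)%R by rewrite normr_gt0.
have a20 : (0 < 2 * `|f x|)%R by rewrite mulr_gt0.
under eq_integral => l _.
  rewrite (_ : (if _ then _ else _) = `|f x|%:E *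
    (if (l < 2 * `|f x|)%R then (l `^ (p - 1 - 1))%:E else 0)); last first.
    by case: ifPn; rewrite ?mule0// muleC EFinM.
  over.
rewrite ge0_integralZl//; last 2 first.
- apply: measurable_funTS; apply: measurable_fun_ifT => //.
    by apply: measurable_fun_ltr => //.
  by apply/measurable_EFinP; exact: measurable_powR.
- by move=> l _; case: ifPn => // _; rewrite lee_fin powR_ge0.
apply: (@le_trans _ _ (`|f x|%:E * ((2 * `|f x|) `^ (p - 1) / `|p - 1|)%:E)).
  apply: lee_wpmul2l; first by rewrite lee_fin.
  apply: integral_halfline_powR_le => //; first by rewrite gt_eqF.
    by apply: measurable_fun_ltr => //.
  move=> l l0 lf2; rewrite ge0_ler_powR ?nnegrE ?ltW//.
rewrite -!EFinM lee_fin (gtr0_norm p10) powRM//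
  -[in leRHS](@mulr_powRB1 _ `|f x| p)//.
by rewrite le_eqVlt; apply/orP; left; apply/eqP; ring.
Qed.

End maximal.

(** * Riesz potentials *)

Section riesz.
Context (R : realType).
Notation mu := (@lebesgue_measure R).
Notation halfline := (`]0%R, +oo[%classic : set R).
Local Open Scope ereal_scope.

(** The Riesz potential of order [b] on the line, without its normalizing
    constant. *)
Definition riesz_potential (b : R) (f : R -> R) (x : R) : \bar R :=
  \int[mu]_y (`|f y| * `|x - y| `^ (b - 1))%:E.

Lemma integral_ball_if (f : R -> R) (x r : R) :
  \int[mu]_y (if (`|x - y| < r)%R then `|f y|%:E else 0) =
  \int[mu]_(y in ball x r) `|f y|%:E.
Proof.
rewrite [RHS]integral_mkcond; apply: eq_integral => y _; rewrite patchE.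
by congr (if _ then _ else _); apply/idP/idP; rewrite inE.
Qed.

Lemma integral_ball_le_HL_maximal (f : R -> R) (x r : R) : (0 < r)%R ->
  \int[mu]_y (if (`|x - y| < r)%R then `|f y|%:E else 0)
    <= (2 * r)%:E * HL_maximal f x.
Proof.
move=> r0; rewrite integral_ball_if.
have r20 : (0 < 2 * r)%R by rewrite mulr_gt0.
rewrite -lee_pdivrMl//.
apply: ereal_sup_ubound => /=; exists r; first by rewrite in_itv/= r0.
rewrite /iavg (lebesgue_measure_ball _ (ltW r0)) inver mulrn_eq0/= gt_eqF//.
by rewrite mulr_natl.
Qed.

(** Hoelder's inequality against the indicator of the ball. *)
Lemma integral_ball_le_Lnorm (p : R) (f : R -> R) (x r : R) :
    (1 < p)%R -> measurable_fun setT f -> (0 < r)%R ->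
  \int[mu]_y (if (`|x - y| < r)%R then `|f y|%:E else 0)
    <= ((2 * r) `^ (1 - p^-1))%:E * 'N[mu]_(p%:E)[EFin \o f].
Proof.
move=> p1 mf r0; have p0 : (0 < p)%R by exact: lt_trans p1.
have r20 : (0 < 2 * r)%R by rewrite mulr_gt0.
have p'0 : (0 < 1 - p^-1)%R by rewrite subr_gt0 invf_lt1.
have mB : measurable (ball x r : set R) by exact: measurable_ball.
have mI : measurable_fun setT (\1_(ball x r) : R ->
  R) by exact: measurable_indic.
have := @hoelder _ _ _ mu f (\1_(ball x r)) p (1 - p^-1)^-1%R mf mI p0.
rewrite invr_gt0 invrK p'0 subrKC => /(_ isT erefl).
rewrite Lnorm1 => H; rewrite integral_ball_if muleC.
apply: le_trans (le_trans _ H) _.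
  rewrite le_eqVlt; apply/orP; left; apply/eqP.
  rewrite [LHS]integral_mkcond; apply: eq_integral => y _.
  rewrite patchE /= indicE; case: ifPn => _; rewrite ?mulr1 ?mulr0 ?normr0//.
rewrite lee_wpmul2l ?Lnorm_ge0// unlock invrK.
rewrite (_ : \int[mu]_x0 _ = mu (ball x r)); last first.
  rewrite -[X in mu X](setIT (ball x r)) -integral_indic//;
    apply: eq_integral => y _.
  rewrite /= indicE; case: (y \in _); rewrite ?normr1 ?normr0 ?powR1 ?powR0//.
  by rewrite invr_eq0 gt_eqF.
by rewrite (lebesgue_measure_ball _ (ltW r0)) poweR_EFin mulr_natl.
Qed.

Lemma powRB1_mulr (x s : R) : (0 < x)%R -> (x `^ (s - 1) * x = x `^ s)%R.
Proof.
move=> x0; rewrite -[X in (_ * X)%R]powRr1 ?ltW// -powRD ?subrK//.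
by rewrite (gt_eqF x0) implybT.
Qed.

(** Up to a constant, [u^(b - 1)] is the integral of [l^(b - 2)] over [l > u]:
    the levels between [2 u] and [4 u] suffice for this inequality. At [u = 0]
    the left-hand side is [0] because the exponent is nonzero. *)
Lemma powR_le_layers (b u : R) : (b < 1)%R -> (0 <= u)%R ->
  (u `^ (b - 1))%:E <= (2 * 4 `^ (1 - b))%:E *
    \int[mu]_(l in halfline) (if (u < l)%R then (l `^ (b - 1 - 1))%:E else 0).
Proof.
move=> b1; set J := \int[mu]_(l in halfline) _.
have J0 : 0 <= J by apply: integral_ge0 => l _; case: ifPn => // _;
  rewrite lee_fin powR_ge0.
rewrite le_eqVlt => /predU1P[<-|u0].
  rewrite powR0 ?subr_eq0 ?lt_eqF// mule_ge0// lee_fin mulr_ge0// powR_ge0.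
have u40 : (0 < 4 * u)%R by rewrite mulr_gt0.
have -> : (u `^ (b - 1) =
    2 * 4 `^ (1 - b) * ((4 * u) `^ (b - 1 - 1) * (4 * u - 2 * u)))%R.
  have -> : (4 * u - 2 * u = 4 * u / 2)%R by lra.
  have E : ((4 * u) `^ (b - 1 - 1) * (4 * u) = 4 `^ (b - 1) * u `^ (b - 1))%R.
    by rewrite powRB1_mulr// powRM ?ltW.
  rewrite (mulrA ((4 * u) `^ _)%R) E -(opprB 1%R b) !powRN.
  by field; rewrite !gt_eqF ?powR_gt0.
rewrite EFinM lee_wpmul2l ?lee_fin ?mulr_ge0 ?powR_ge0//.
apply: integral_halfline_ge; rewrite ?powR_ge0//.
- by rewrite mulr_gt0.
- by lra.
- apply: measurable_funTS; apply: measurable_fun_ifT => //.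
    by apply: measurable_fun_ltr => //; exact: measurable_cst.
  by apply/measurable_EFinP; exact: measurable_powR.
- by move=> l _; case: ifPn => // _; rewrite lee_fin powR_ge0.
- move=> l /andP[ul lu]; rewrite ifT; last by lra.
  have l0 : (0 < l)%R by lra.
  rewrite lee_fin -(opprK (b - 1 - 1)%R) [leLHS]powRN [leRHS]powRN.
  rewrite lef_pV2 ?posrE ?powR_gt0//.
  by rewrite ge0_ler_powR ?nnegrE//; lra.
Qed.

(** With [A l] the mass of [|f|] in [ball x l], the potential is at most a
    multiple of the integral of [l^(b - 2) * A l] over [l > 0], where
    [b = 1/p - 1/q]. Below [d] the bound [A l <= 2 l M f x] leaves [l^(b - 1)],
    integrable at [0]; above [d] the bound by the [L^p] norm leaves
    [l^(-1/q - 1)], integrable at [+oo]. *)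
Lemma riesz_potential_split (p q : R) : (1 < p)%R -> (p < q)%R ->
  exists2 c : R, (0 < c)%R & forall (f : R -> R) (x d : R),
    measurable_fun setT f -> 0 <= HL_maximal f x -> (0 < d)%R ->
    riesz_potential (p^-1 - q^-1) f x <=
      c%:E * ((d `^ (p^-1 - q^-1))%:E * HL_maximal f x +
              (d `^ (- q^-1))%:E * 'N[mu]_(p%:E)[EFin \o f]).
Proof.
move=> p1 pq; have p0 : (0 < p)%R by exact: lt_trans p1.
have q0 : (0 < q)%R by exact: lt_trans pq.
set b := (p^-1 - q^-1)%R.
have b0 : (0 < b)%R by rewrite subr_gt0 ltf_pV2.
have b1 : (b < 1)%R.
  by apply: (@le_lt_trans _ _ p^-1%R); rewrite ?invf_lt1// gerBl invr_ge0 ltW.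
have qV0 : (0 < q^-1)%R by rewrite invr_gt0.
(* K comes from the layers; c1 and c2 come from the radii below and above d. *)
pose K := (2 * 4 `^ (1 - b))%R.
pose c1 := (2 / b)%R.
pose c2 := (2 `^ (1 - p^-1) * q)%R.
have K0 : (0 < K)%R by rewrite mulr_gt0 ?powR_gt0.
have c10 : (0 < c1)%R by rewrite divr_gt0.
have c20 : (0 < c2)%R by rewrite mulr_gt0 ?powR_gt0.
exists (K * (c1 + c2))%R; first by rewrite mulr_gt0 ?addr_gt0.
move=> f x d mf M0 d0.
set M := HL_maximal f x; set N := 'N[mu]_(p%:E)[EFin \o f].
have N0 : 0 <= N by exact: Lnorm_ge0.
pose k (z : R * R) : \bar R :=
  if (`|x - z.1| < z.2)%R then (z.2 `^ (b - 1 - 1) * `|f z.1|)%:E else 0.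
have k0 z : 0 <= k z.
  by rewrite /k; case: ifPn => // _; rewrite lee_fin mulr_ge0// powR_ge0.
have mf1 : measurable_fun setT (fun z : R * R => `|f z.1|%R).
  by apply: measurableT_comp => //; exact: (measurableT_comp mf).
have mk : measurable_fun setT k.
  apply: measurable_fun_ifT => //.
    apply: measurable_fun_ltr => //.
    by apply: measurableT_comp => //; exact: measurable_funB.
  apply/measurable_EFinP; apply: measurable_funM => //.
  exact: (measurableT_comp (measurable_powR _)).
have kE y l : k (y, l) = `|f y|%:E *
    (if (`|x - y| < l)%R then (l `^ (b - 1 - 1))%:E else 0).
  by rewrite /k /=; case: ifPn; rewrite ?mule0// muleC EFinM.
have kE' y l : k (y, l) = (l `^ (b - 1 - 1))%:E *
    (if (`|x - y| < l)%R then `|f y|%:E else 0).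
  by rewrite /k /=; case: ifPn; rewrite ?mule0// EFinM.
have mlayer y : measurable_fun setT
    (fun l : R => if (`|x - y| < l)%R then (l `^ (b - 1 - 1))%:E else 0 : \bar
      R).
  apply: measurable_fun_ifT => //; first exact: measurable_fun_ltr.
  by apply/measurable_EFinP; exact: measurable_powR.
have layer0 y l : 0 <= (if (`|x - y| < l)%R then (l `^ (b - 1 - 1))%:E else 0 :
  \bar R).
  by case: ifPn => // _; rewrite lee_fin powR_ge0.
rewrite EFinM -muleA; apply: (@le_trans _ _ (K%:E *
    \int[mu]_y \int[mu]_(l in halfline) k (y, l))).
  rewrite -ge0_integralZl//; last 3 first.
  - exact: measurable_fun_halfline_fubini.
  - by move=> y _; exact: integral_ge0.
  - by rewrite lee_fin ltW.
  apply: ge0_le_integral => //.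
  - apply/measurable_EFinP; apply: measurable_funM;
      first exact: measurableT_comp.
    apply: (measurableT_comp (measurable_powR _));
      apply: measurableT_comp => //.
    exact: measurable_funB.
  - apply: emeasurable_funM; first exact: measurable_cst.
    exact: measurable_fun_halfline_fubini.
  move=> y _; under eq_integral do rewrite kE.
  rewrite ge0_integralZl//; last exact: (measurable_funTS (mlayer y)).
  rewrite muleCA EFinM; apply: lee_wpmul2l; first by rewrite lee_fin.
  exact: powR_le_layers.
apply: lee_wpmul2l; first by rewrite lee_fin ltW.
rewrite fubini_tonelli_halfline//.
pose near (l : R) : \bar R := if (l < d)%R then (l `^ (b - 1))%:E else 0.
pose far (l : R) : \bar R := if (d <= l)%R then (l `^ (- q^-1 - 1))%:E else 0.
have near0 l : 0 <= near l by rewrite /near; case: ifPn => // _;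
  rewrite lee_fin powR_ge0.
have far0 l : 0 <= far l by rewrite /far; case: ifPn => // _;
  rewrite lee_fin powR_ge0.
have mnear : measurable_fun setT near.
  apply: measurable_fun_ifT => //; first exact: measurable_fun_ltr.
  by apply/measurable_EFinP; exact: measurable_powR.
have mfar : measurable_fun setT far.
  apply: measurable_fun_ifT => //; first exact: measurable_fun_ler.
  by apply/measurable_EFinP; exact: measurable_powR.
have MN0 : 0 <= (2 `^ (1 - p^-1))%:E * N by rewrite mule_ge0// lee_fin powR_ge0.
have M20 : 0 <= 2%:E * M by rewrite mule_ge0.
apply: (@le_trans _ _ (\int[mu]_(l in halfline)
    ((2%:E * M) * near l + ((2 `^ (1 - p^-1))%:E * N) * far l))).
  apply: ge0_le_integral => //.
  - by move=> l _; exact: integral_ge0.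
  - apply: measurable_funTS.
    exact: (@measurable_fun_fubini_tonelli_G _ _ _ _ _ mu k mk k0).
  - apply: measurable_funTS; apply: emeasurable_funD.
      by apply: emeasurable_funM => //; exact: measurable_cst.
    by apply: emeasurable_funM => //; exact: measurable_cst.
  suff pw (l : R) : (0 < l)%R -> \int[mu]_y k (y, l) <=
      2%:E * M * near l + (2 `^ (1 - p^-1))%:E * N * far l.
    by move=> l; rewrite /= in_itv/= andbT; exact: pw.
  move=> l0; under eq_integral do rewrite kE'.
  have l0' := powR_ge0 l (b - 1 - 1).
  rewrite ge0_integralZl//; last 2 first.
  - apply: measurable_fun_ifT => //.
      apply: measurable_fun_ltr => //; apply: measurableT_comp => //.
      exact: measurable_funB.
    by apply/measurable_EFinP; exact: measurableT_comp.
  - by move=> y _; case: ifPn.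
  rewrite /near /far; case: ltP => [ld|dl].
    rewrite mule0 adde0.
    apply: le_trans (lee_wpmul2l _ (integral_ball_le_HL_maximal f x l0)) _ =>
      //.
    rewrite muleA -EFinM muleAC -EFinM lee_wpmul2r// lee_fin.
    by rewrite mulrCA powRB1_mulr.
  rewrite mule0 add0e.
  apply: le_trans (lee_wpmul2l _ (integral_ball_le_Lnorm x p1 mf l0)) _ => //.
  rewrite muleA -EFinM muleAC -EFinM lee_wpmul2r// lee_fin.
  rewrite powRM ?(ltW l0)// mulrCA -powRD; last by rewrite (gt_eqF l0) implybT.
  rewrite (_ : b - 1 - 1 + (1 - p^-1) = - q^-1 - 1)%R//.
  by rewrite /b; ring.
have mMn : measurable_fun halfline (fun l => 2%:E * M * near l).
  by apply: measurable_funTS; apply: emeasurable_funM => //;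
    exact: measurable_cst.
have mNf : measurable_fun halfline (fun l => (2 `^ (1 - p^-1))%:E * N * far l).
  by apply: measurable_funTS; apply: emeasurable_funM => //;
    exact: measurable_cst.
rewrite ge0_integralD//; last 2 first.
- by move=> l _; rewrite mule_ge0.
- by move=> l _; rewrite mule_ge0.
rewrite !ge0_integralZl//; try exact: measurable_funTS.
have nearI : \int[mu]_(l in halfline) near l <= (d `^ b / b)%:E.
  have := @integral_halfline_powR_le R b d (fun l => (l < d)%R).
  rewrite gtr0_norm//; apply => //; first by rewrite gt_eqF.
    exact: measurable_fun_ltr.
  by move=> l l0 ld; rewrite ge0_ler_powR ?nnegrE ?ltW.
have farI : \int[mu]_(l in halfline) far l <= (d `^ (- q^-1) * q)%:E.
  have := @integral_halfline_powR_le R (- q^-1) d (fun l => (d <= l)%R).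
  rewrite normrN gtr0_norm// invrK; apply => //;
    first by rewrite oppr_eq0 gt_eqF.
    exact: measurable_fun_ler.
  move=> l l0 dl; rewrite !powRN lef_pV2 ?posrE ?powR_gt0//.
  by rewrite ge0_ler_powR ?nnegrE//; exact: ltW.
apply: le_trans (leeD (lee_wpmul2l M20 nearI) (lee_wpmul2l MN0 farI)) _.
rewrite ge0_muleDr ?mule_ge0 ?lee_fin ?powR_ge0//.
apply: leeD.
  rewrite muleAC -EFinM muleA -EFinM lee_wpmul2r// lee_fin.
  rewrite (mulrDl c1) (_ : 2 * (d `^ b / b) = c1 * d `^ b)%R;
    last by rewrite /c1; ring.
  by rewrite lerDl mulr_ge0 ?powR_ge0// ltW.
rewrite muleAC -EFinM muleA -EFinM lee_wpmul2r// lee_fin.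
rewrite (mulrDl c1) [X in (X <= _)%R](_ : _ = c2 * d `^ (- q^-1))%R;
  last by rewrite /c2; ring.
by rewrite lerDr mulr_ge0 ?powR_ge0// ltW.
Qed.

End riesz.

Section hls.
Context (R : realType).
Notation mu := (@lebesgue_measure R).
Local Open Scope ereal_scope.

Lemma HL_maximal_Lnorm0 (p : R) (f : R -> R) (x : R) : (1 < p)%R ->
  measurable_fun setT f -> 'N[mu]_(p%:E)[EFin \o f] = 0 -> HL_maximal f x <= 0.
Proof.
move=> p1 mf f0; apply: ge_ereal_sup => _ [r /= + <-].
rewrite in_itv/= andbT => r0.
have := integral_ball_le_Lnorm x p1 mf r0;
  rewrite integral_ball_if f0 mule0 => I0.
rewrite /iavg (_ : \int[mu]_(y in _) _ = 0) ?mule0//.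
by apply/eqP; rewrite eq_le I0/= integral_ge0.
Qed.

(** A compact set lies in a ball, where Hoelder's inequality applies. *)
Lemma Lfun_locally_integrable (p : R) (f : R -> R) : (1 < p)%R ->
  f \in Lfun mu p%:E -> locally_integrable setT f.
Proof.
move=> p1; rewrite inE => /andP[/[!inE]/= mf lpf].
split; [exact: mf|exact: openT|move=> K _ cK].
have [r [r0 Kr]] : exists r : R, (0 < r)%R /\ K `<=` ball (0%R : R) r.
  have [r [_ rK]] := compact_bounded cK.
  exists (`|r| + 2)%R; split; first by rewrite ltr_wpDl.
  move=> y Ky; rewrite /ball/= sub0r normrN.
  have := rK (`|r| + 1)%R _ y Ky; move=> /(_ _)/le_lt_trans; apply.
    by rewrite (le_lt_trans (ler_norm r))// ltrDl.
  by rewrite ltrD2l ltr1n.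
apply: (@le_lt_trans _ _ (\int[mu]_(y in ball (0%R : R) r) `|f y|%:E)).
  apply: ge0_subset_integral => //.
  - exact: compact_measurable.
  - exact: measurable_ball.
  - by apply/measurable_EFinP/measurableT_comp => //; exact: measurable_funTS.
rewrite -integral_ball_if;
  apply: le_lt_trans (integral_ball_le_Lnorm _ p1 mf r0) _.
by rewrite lte_mul_pinfty ?lee_fin ?powR_ge0.
Qed.

(** For [n > 0] the two terms on the right of the hypothesis balance at
    [d = (n / M)^p]. When [M = 0] that choice is not available, but letting [d]
    tend to [+oo] gives [X <= 0]. *)
Lemma ereal_interpolation (p q c n : R) (X M : \bar R) :
    (1 < p)%R -> (p < q)%R -> (0 < c)%R -> (0 <= n)%R -> 0 <= M ->
    (n = 0%R -> M = 0) ->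
    (forall d : R, (0 < d)%R ->
       X <= c%:E * ((d `^ (p^-1 - q^-1))%:E * M + (d `^ (- q^-1))%:E * n%:E)) ->
  X <= (2 * c)%:E * ((n `^ (1 - p / q))%:E * M `^ (p / q)).
Proof.
move=> p1 pq c0; have p0 : (0 < p)%R by exact: lt_trans p1.
have q0 : (0 < q)%R by exact: lt_trans pq.
have pq0 : (0 < p / q)%R by rewrite divr_gt0.
have c20 : (0 < 2 * c)%R by rewrite mulr_gt0.
rewrite le_eqVlt => /predU1P[<- _ /(_ erefl) -> /(_ 1%R ltr01)|n0].
  rewrite !mule0 adde0 mule0 => /le_trans; apply.
  by rewrite !mule_ge0 ?poweR_ge0// lee_fin ?powR_ge0// ltW.
case: M => [m| |//]; last first.
  move=> _ _ _; rewrite poweRyr ?gt_eqF// gt0_muley ?lte_fin ?powR_gt0//.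
  by rewrite gt0_muley ?lte_fin// leey.
rewrite lee_fin le_eqVlt => /predU1P[<- _ XE|m0 _].
  rewrite poweR0r ?gt_eqF// !mule0; apply/lee_addgt0Pr => e e0; rewrite add0e.
  have cn0 : (0 < c * n)%R by rewrite mulr_gt0.
  (* This d makes the remaining term equal to e. *)
  have := XE ((e / (c * n)) `^ (- q))%R;
    rewrite powR_gt0 ?divr_gt0// => /(_ isT).
  rewrite mule0 add0e -powRrM mulrNN divff ?gt_eqF//
    powRr1 ?divr_ge0 ?(ltW e0) ?(ltW cn0)//.
  rewrite -!EFinM (_ : c * (e / (c * n) * n) = e)%R//.
  by field; rewrite !gt_eqF.
have nm0 : (0 < n / m)%R by rewrite divr_gt0.
move=> /(_ ((n / m) `^ p)%R); rewrite powR_gt0// => /(_ isT) /le_trans; apply.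
rewrite poweR_EFin -!EFinM -?EFinD -?EFinM lee_fin -!powRrM.
have nmE s : ((n / m) `^ s = n `^ s * m `^ (- s))%R.
  by rewrite powRM ?invr_ge0 ?(ltW n0) ?(ltW m0)// -powR_inv1 ?(ltW m0)//
    -powRrM mulN1r.
rewrite (_ : p * (p^-1 - q^-1) = 1 - p / q)%R; last by field; rewrite !gt_eqF.
rewrite (_ : p * - q^-1 = - (p / q))%R; last by rewrite mulrN.
have -> : ((n / m) `^ (1 - p / q) * m = n `^ (1 - p / q) * m `^ (p / q))%R.
  rewrite nmE -mulrA; congr (_ * _)%R;
    rewrite -[X in (_ * X)%R]powRr1 ?(ltW m0)//.
  by rewrite -powRD ?(gt_eqF m0) ?implybT//; congr (_ `^ _)%R; ring.
have -> : ((n / m) `^ (- (p / q)) * n = n `^ (1 - p / q) * m `^ (p / q))%R.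
  rewrite nmE opprK mulrAC; congr (_ * _)%R;
    rewrite -[X in (_ * X)%R]powRr1 ?(ltW n0)//.
  by rewrite -powRD ?(gt_eqF n0) ?implybT//; congr (_ `^ _)%R; ring.
by rewrite le_eqVlt; apply/orP; left; apply/eqP; ring.
Qed.

Lemma measurable_riesz_potential (b : R) (f : R -> R) : measurable_fun setT f ->
  measurable_fun setT (riesz_potential b f).
Proof.
move=> mf.
apply: (@measurable_fun_fubini_tonelli_F _ _ _ _ _ mu
  (fun z : R * R => (`|f z.2| * `|z.1 - z.2| `^ (b - 1))%:E)).
  apply/measurable_EFinP; apply: measurable_funM.
    by apply: measurableT_comp => //; exact: (measurableT_comp mf).
  apply: (measurableT_comp (measurable_powR _)); apply: measurableT_comp => //.
  exact: measurable_funB.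
by move=> z; rewrite lee_fin mulr_ge0// powR_ge0.
Qed.

Lemma invK_powR (q x : R) : q != 0%R -> (0 <= x)%R -> ((x `^ q) `^ q^-1 = x)%R.
Proof. by move=> q0 x0; rewrite -powRrM divff// powRr1. Qed.

Lemma le_poweR (r : R) (x y : \bar R) :
  (0 <= r)%R -> 0 <= x -> x <= y -> x `^ r <= y `^ r.
Proof.
move=> r0 x0 xy; apply: gt0_ler_poweR => //; rewrite in_itv/= leey andbT//.
exact: le_trans xy.
Qed.

Lemma le_Lnorm (q : R) (F G : R -> \bar R) : (0 < q)%R ->
  measurable_fun setT F -> measurable_fun setT G ->
  (forall x, 0 <= F x) -> (forall x, F x <= G x) ->
    'N[mu]_(q%:E)[F] <= 'N[mu]_(q%:E)[G].
Proof.
move=> q0 mF mG F0 FG; rewrite unlock.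
have G0 x : 0 <= G x by exact: le_trans (FG x).
have mpow (H : R -> \bar R) : measurable_fun setT H ->
  measurable_fun setT (fun x => `|H x| `^ q).
  move=> mH; apply: (measurableT_comp (measurable_poweR _)).
  exact: measurableT_comp.
apply: le_poweR; first by rewrite invr_ge0 ltW.
  by apply: integral_ge0 => x _; exact: poweR_ge0.
apply: ge0_le_integral => //.
- by move=> x _; exact: poweR_ge0.
- exact: mpow.
- exact: mpow.
move=> x _; apply: le_poweR; rewrite ?(ltW q0)//.
by rewrite !gee0_abs.
Qed.

(** Balancing the split gives Hedberg's pointwise inequality, by a multiple of
    [n^(1 - p/q) * (M f x)^(p/q)] with [n] the [L^p] norm of [f]; its [q]-th
    power is a multiple of [(M f x)^p], which the strong type bound
    integrates. *)
Theorem hardy_littlewood_sobolev (p q : R) : (1 < p)%R -> (p < q)%R ->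
  exists2 C : R, (0 < C)%R & forall f : R -> R, f \in Lfun mu p%:E ->
    'N[mu]_(q%:E)[riesz_potential (p^-1 - q^-1) f]
      <= C%:E * 'N[mu]_(p%:E)[EFin \o f].
Proof.
move=> p1 pq; have p0 : (0 < p)%R by exact: lt_trans p1.
have q0 : (0 < q)%R by exact: lt_trans pq.
have [c c0 split_le] := riesz_potential_split p1 pq.
have [C C0 strong] := HL_maximal_strong_type p1.
have c20 : (0 < 2 * c)%R by rewrite mulr_gt0.
exists (2 * c * C `^ q^-1)%R; first by rewrite mulr_gt0// powR_gt0.
move=> f Lf; have lf := Lfun_locally_integrable p1 Lf.
have mf : measurable_fun setT f by have [] := lf.
have mM := measurable_HL_maximal lf.
have M0 := HL_maximalT_ge0 lf.
have [n n0 NE] : exists2 n : R, (0 <= n)%R & 'N[mu]_(p%:E)[EFin \o f] = n%:E.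
  move: Lf; rewrite inE => /andP[_ /[!inE]/= Nf].
  have N0 := @Lnorm_ge0 _ _ _ mu p%:E (EFin \o f).
  exists (fine ('N[mu]_(p%:E)[EFin \o f])); first exact: fine_ge0.
  by rewrite fineK// ge0_fin_numE.
have IE : \int[mu]_x (`|f x| `^ p)%:E = (n `^ p)%:E.
  have := @poweR_Lnorm _ _ _ mu (EFin \o f) p; rewrite gt_eqF// => /(_ isT).
  by rewrite NE poweR_EFin => ->.
have hedberg x : riesz_potential (p^-1 - q^-1) f x <=
    (2 * c)%:E * ((n `^ (1 - p / q))%:E * HL_maximal f x `^ (p / q)).
  apply: ereal_interpolation => //.
  - move=> nE0; apply/eqP; rewrite eq_le M0 andbT.
    by apply: HL_maximal_Lnorm0 p1 mf _; rewrite NE nE0.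
  - by move=> d d0; rewrite -NE; exact: split_le.
have R0 x : 0 <= riesz_potential (p^-1 - q^-1) f x.
  by apply: integral_ge0 => y _; rewrite lee_fin mulr_ge0// powR_ge0.
have mB : measurable_fun setT (fun x =>
    (2 * c)%:E * ((n `^ (1 - p / q))%:E * HL_maximal f x `^ (p / q))).
  apply: emeasurable_funM; first exact: measurable_cst.
  apply: emeasurable_funM; first exact: measurable_cst.
  exact: (measurableT_comp (measurable_poweR _)).
apply: le_trans (le_Lnorm q0 (measurable_riesz_potential _ mf) mB R0 hedberg) _.
rewrite NE unlock.
under eq_integral => x _.
  rewrite gee0_abs; last first.
    by rewrite !mule_ge0 ?poweR_ge0// lee_fin ?powR_ge0// ltW.
  rewrite muleA -EFinM poweRM ?poweR_ge0 ?lee_fin ?mulr_ge0 ?powR_ge0 ?(ltW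
    c0)//.
  rewrite -poweRrM divfK ?gt_eqF// poweR_EFin.
  over.
rewrite /= ge0_integralZl ?lee_fin ?powR_ge0//; last 2 first.
- exact: (measurableT_comp (measurable_poweR _)).
- by move=> x _; exact: poweR_ge0.
rewrite -EFinM. have -> : (2 * c * C `^ q^-1 * n)%:E =
    ((2 * c * n `^ (1 - p / q)) `^ q * (C * n `^ p))%:E `^ q^-1.
  rewrite poweR_EFin; congr (_%:E).
  have Cq0 := powR_ge0 C q^-1.
  have T0 : (0 <= 2 * c * C `^ q^-1 * n)%R by rewrite !mulr_ge0// ltW.
  rewrite -[LHS](@invK_powR q) ?gt_eqF//; congr (_ `^ _)%R.
  have cC0 : (0 <= 2 * c * C `^ q^-1)%R by rewrite !mulr_ge0// ltW.
  rewrite (powRM _ cC0 n0) (powRM _ (ltW c20) Cq0).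
  rewrite [in RHS](powRM _ (ltW c20) (powR_ge0 _ _)) -!powRrM.
  rewrite mulVf ?gt_eqF// powRr1 ?(ltW C0)//.
  rewrite -[LHS]mulrA -[RHS]mulrA; congr (_ * _)%R.
  have E : ((1 - p / q) * q + p = q)%R by field; rewrite gt_eqF.
  by rewrite [RHS]mulrCA -powRD E// gt_eqF.
apply: le_poweR; first by rewrite invr_ge0 ltW.
  by rewrite mule_ge0 ?lee_fin ?powR_ge0// integral_ge0// => x _;
    exact: poweR_ge0.
rewrite EFinM lee_wpmul2l ?lee_fin ?powR_ge0// EFinM -IE.
exact: strong.
Qed.

End hls.

(** * Domination by a Riesz potential *)

Section curve.
Context (R : realType).
Notation mu := (@lebesgue_measure R).

(** Adding [e * t] makes the function strictly increasing, so its derivative is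
    at least [- e] for every [e > 0]. *)
Lemma nondecreasing_derive1_ge0 (f : R -> R) (t : R) :
    (forall u : R, 0 < u -> derivable f u 1) ->
    (forall u v : R, 0 < u -> u <= v -> f u <= f v) ->
  0 < t -> 0 <= derive1 f t.
Proof.
move=> df ndf t0; apply/ler_addgt0Pr => e e0.
pose g u := f u + e * u.
have dg (u : R) : 0 < u -> is_derive u 1 g (derive1 f u + e).
  move=> u0; have fu : is_derive u 1 f (derive1 f u).
    by rewrite derive1E; apply: derivableP; exact: df.
  have := is_deriveD fu (is_deriveZ e (is_derive_id u (1 : R))).
  by rewrite /GRing.scale/= mulr1.
have -> : derive1 f t + e = derive1 g t.
  by have [_ <-] := dg t t0; rewrite [RHS]derive1E.
apply: (@incr_derive1_ge0_itvy _ g false 0).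
- by move=> u; rewrite inE/= in_itv/= andbT => /dg[].
- move=> u v; rewrite !in_itv/= !andbT => u0 v0 uv.
  by rewrite ler_ltD ?ltr_pM2l// ndf// ltW.
- by rewrite in_itv/= andbT.
Qed.

(** Since the limit at [0] is [0], the function is nonnegative if it increases
    and nonpositive if it decreases. *)
Lemma monotonic_pos_sign (gamma : R -> R) :
    monotonic_pos gamma -> gamma t @[t --> 0^'+] --> (0 : R) ->
  exists s : R, [/\ `|s| = 1,
    (forall t : R, 0 < t -> s * gamma t = `|gamma t|) &
    (forall t u : R, 0 < t -> t <= u -> s * gamma t <= s * gamma u)].
Proof.
move=> mono g0.
have near_lt (t : R) : 0 < t -> \forall u \near 0^'+, 0 < u <= t.
  move=> t0; near=> u; apply/andP; split; near: u.
    exact: nbhs_right_gt.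
  exact: nbhs_right_ltW.
case: mono => mono.
  have nd t u : 0 < t -> t <= u -> gamma t <= gamma u.
    by move=> t0 tu; apply: mono; rewrite ?in_itv/= ?andbT// (lt_le_trans t0).
  exists 1; split; [by rewrite normr1| |by move=> t u; rewrite !mul1r;
    exact: nd].
  move=> t t0; rewrite mul1r ger0_norm//.
  apply: (cvgr_to_le g0); have := near_lt t t0.
  by apply: filterS => u /andP[u0 ut]; exact: nd.
have nd t u : 0 < t -> t <= u -> gamma u <= gamma t.
  move=> t0 tu; apply: mono => //; rewrite in_itv/= andbT//.
  exact: lt_le_trans tu.
exists (-1); split; first by rewrite normrN normr1.
  move=> t t0; rewrite mulN1r ler0_norm//.
  apply: (cvgr_to_ge g0); have := near_lt t t0.
  by apply: filterS => u /andP[u0 ut]; exact: nd.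
by move=> t u t0 tu; rewrite !mulN1r lerN2; exact: nd.
Unshelve. all: by end_near. Qed.

(** The hypotheses on the indices give [t^M <= |gamma t|] for [t <= a] and for
    [t >= T]. For [t] in between, [|gamma t| >= |gamma a| >= a^M], and [a^M] is
    at least [(a / T)^M * t^M]. *)
Lemma power_lower_bound (gamma : R -> R) (M : R) :
    (forall t : R, 0 < t -> gamma t != 0) ->
    (forall t u : R, 0 < t -> t <= u -> `|gamma t| <= `|gamma u|) ->
    0 < M -> (omega02 gamma < M%:E)%E -> (M%:E < omegaoo1 gamma)%E ->
  exists2 c : R, 0 < c & forall t : R, 0 < t -> c * t `^ M <= `|gamma t|.
Proof.
move=> gn0 nd M0.
rewrite /omega02 limf_esupE => /ereal_inf_lt[_ [V V0 <-] VM].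
rewrite /omegaoo1 limf_einfE => /ereal_sup_gt[_ [W Woo <-] WM].
have small (t : R) : V t -> 0 < t -> t < 1 -> t `^ M <= `|gamma t|.
  move=> Vt t0 t1.
  have : (log_ratio gamma t < M%:E)%E.
    by apply: le_lt_trans VM; apply: ereal_sup_ubound; exists t.
  rewrite /log_ratio lte_fin ltr_ndivrMr ?ln_lt0 ?t0// => H.
  rewrite /powR gt_eqF// -[leRHS]lnK ?posrE ?normr_gt0 ?gn0//.
  by rewrite ler_expR ltW.
have large (t : R) : W t -> 1 < t -> t `^ M <= `|gamma t|.
  move=> Wt t1; have t0 : 0 < t by exact: lt_trans t1.
  have : (M%:E < log_ratio gamma t)%E.
    by apply: (lt_le_trans WM); apply: ereal_inf_lbound; exists t.
  rewrite /log_ratio lte_fin ltr_pdivlMr ?ln_gt0// => H.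
  rewrite /powR gt_eqF// -[leRHS]lnK ?posrE ?normr_gt0 ?gn0//.
  by rewrite ler_expR ltW.
have [e /= e0 eV] := V0; have [A [_ AW]] := Woo.
pose a := Num.min (e / 2) (1 / 2).
pose T := Num.max A 1 + 1.
have a0 : 0 < a by rewrite lt_min !divr_gt0.
have a1 : a < 1 by rewrite gt_min; apply/orP; right; lra.
have T1 : 1 < T.
  apply: (@le_lt_trans _ _ (Num.max A 1)); first by rewrite le_max lexx orbT.
  by rewrite ltrDl.
have T0 : 0 < T by exact: lt_trans T1.
have smallP (t : R) : 0 < t -> t <= a -> t `^ M <= `|gamma t|.
  move=> t0 ta; apply: small => //; last exact: le_lt_trans a1.
  apply: eV => //=; rewrite sub0r normrN gtr0_norm//.
  by rewrite (le_lt_trans ta)// gt_min; apply/orP; left; lra.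
have largeP (t : R) : T <= t -> t `^ M <= `|gamma t|.
  move=> Tt; apply: large; last exact: lt_le_trans Tt.
  apply: AW; apply: lt_le_trans Tt.
  apply: (@le_lt_trans _ _ (Num.max A 1)); first by rewrite le_max lexx.
  by rewrite ltrDl.
exists ((a / T) `^ M); first by apply: powR_gt0; rewrite divr_gt0.
have c1 : (a / T) `^ M <= 1.
  have aT : a / T <= 1 by rewrite ler_pdivrMr// mul1r (le_trans (ltW a1))// ltW.
  have aT0 : 0 <= a / T by rewrite divr_ge0// ltW.
  by have := ge0_ler_powR (ltW M0) aT0 ler01 aT; rewrite powR1.
have cle (t : R) : t `^ M <= `|gamma t| -> (a / T) `^ M * t `^ M <= `|gamma t|.
  by apply: le_trans; rewrite ler_piMl ?powR_ge0.
move=> t t0; have [ta|/ltW at_] := leP t a; first exact/cle/smallP.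
have [Tt|/ltW tT] := leP T t; first exact/cle/largeP.
apply: le_trans (nd a t a0 at_); apply: le_trans (smallP a a0 (lexx a)).
rewrite -powRM ?divr_ge0 ?(ltW a0) ?(ltW T0) ?(ltW t0)//.
rewrite ge0_ler_powR ?nnegrE ?(ltW M0) ?(ltW a0) ?mulr_ge0 ?invr_ge0 ?(ltW T0)
  ?(ltW a0) ?(ltW t0)//.
by rewrite mulrAC ler_pdivrMr// ler_pM2l.
Qed.

End curve.

Section fractional.
Context (R : realType).
Notation mu := (@lebesgue_measure R).
Notation halfline := (`]0%R, +oo[%classic : set R).

(** Nothing is known about [gamma] on the nonpositive reals; replacing it there
    by [0] makes the kernel of the operator jointly measurable on the plane, as
    Tonelli's theorem requires. *)
Lemma measurable_halfline_patch (gamma : R -> R) :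
    (forall t : R, 0 < t -> derivable gamma t 1) ->
  measurable_fun setT (fun t : R => if 0 < t then gamma t else 0).
Proof.
move=> dg.
have mg : measurable_fun halfline gamma.
  apply: open_continuous_measurable_fun; first exact: interval_open.
  move=> t; rewrite inE/= in_itv/= andbT => t0.
  by apply/differentiable_continuous/derivable1_diffP; exact: dg.
have := (measurable_restrictT gamma (measurable_itv `]0%R, +oo[)).1 mg.
apply: eq_measurable_fun => t _.
by rewrite patchE mem_setE in_itv/= andbT.
Qed.

Lemma measurable_fractional_kernel (alpha : R) (gamma f : R -> R) :
    (forall t : R, 0 < t -> derivable gamma t 1) -> measurable_fun setT f ->
  measurable_fun setT (fun z : R * R =>
    (`|f (z.1 - (if 0 < z.2 then gamma z.2 else 0))| / z.2 `^ (1 - alpha))%:E).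
Proof.
move=> dg mf; apply/measurable_EFinP; apply: measurable_funM.
  apply: measurableT_comp => //; apply: (measurableT_comp mf).
  apply: measurable_funB => //.
  exact: (measurableT_comp (measurable_halfline_patch dg)).
under eq_fun do rewrite -powRN.
exact: (measurableT_comp (measurable_powR _)).
Qed.

Lemma fractional_integralE (alpha : R) (gamma f : R -> R) (x : R) :
  fractional_integral alpha gamma f x =
  (\int[mu]_(t in halfline)
    (`|f (x - (if 0 < t then gamma t else 0))| / t `^ (1 - alpha))%:E)%E.
Proof.
by apply: eq_integral => t; rewrite inE/= in_itv/= andbT => ->.
Qed.

Lemma measurable_fractional_integral (alpha : R) (gamma f : R -> R) :
    (forall t : R, 0 < t -> derivable gamma t 1) -> measurable_fun setT f ->
  measurable_fun setT (fractional_integral alpha gamma f).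
Proof.
move=> dg mf; rewrite (_ : fractional_integral alpha gamma f = (fun x =>
  \int[mu]_(t in halfline)
    (`|f (x - (if 0 < t then gamma t else 0))| / t `^ (1 - alpha))%:E)%E).
  2: by apply/funext => x; exact: fractional_integralE.
apply: (measurable_fun_halfline_fubini (measurable_fractional_kernel alpha dg
  mf)) => z.
by rewrite lee_fin divr_ge0// powR_ge0.
Qed.

Lemma measurable_fractional_integrand (alpha : R) (gamma f : R -> R) (x : R) :
    (forall t : R, 0 < t -> derivable gamma t 1) -> measurable_fun setT f ->
  measurable_fun halfline (fun t => (`|f (x - gamma t)| / t `^ (1 - alpha))%:E).
Proof.
move=> dg mf.
have := measurableT_comp (measurable_fractional_kernel alpha dg mf)
  (pair1_measurable x).
move=> /(@measurable_funTS _ _ _ _ halfline); apply: eq_measurable_fun => t.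
by rewrite inE/= in_itv/= andbT => ->.
Qed.

Lemma LnormZ_ge0 (q K : R) (F : R -> \bar R) : (0 < q)%R -> (0 <= K)%R ->
  measurable_fun setT F -> (forall x, 0 <= F x)%E ->
  ('N[mu]_(q%:E)[(fun x => K%:E * F x)] = K%:E * 'N[mu]_(q%:E)[F])%E.
Proof.
move=> q0 K0 mF F0; rewrite unlock.
have mF' : measurable_fun setT (fun x => F x `^ q)%E.
  exact: (measurableT_comp (measurable_poweR _)).
have I0 : (0 <= \int[mu]_x (F x `^ q))%E.
  by apply: integral_ge0 => x _; exact: poweR_ge0.
transitivity ((\int[mu]_x ((K `^ q)%:E * F x `^ q)) `^ q^-1)%E.
  congr poweR; apply: eq_integral => x _.
  by rewrite gee0_abs ?mule_ge0// poweRM.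
rewrite ge0_integralZl ?lee_fin ?powR_ge0//; last by move=> x _;
  exact: poweR_ge0.
rewrite poweRM ?lee_fin ?powR_ge0// poweR_EFin invK_powR ?gt_eqF//.
congr (_ * poweR _ _)%E; apply: eq_integral => x _.
by rewrite gee0_abs.
Qed.

(** For [t > 0], the lower bound on [t |gamma' t| / |gamma t|] gives
    [1/t <= |gamma' t| / (C1 |gamma t|)], and the lower bound on [|gamma t|]
    gives [t^alpha <= (|gamma t| / c)^(alpha / M)]. Their product bounds
    [t^(alpha - 1)] by a multiple of [|gamma t|^(alpha / M - 1) * |gamma' t|],
    and [|gamma t|] is the distance from [x] to [y = x - gamma t]. *)
Lemma fractional_integral_le_riesz (alpha M C1 c : R) (gamma f : R ->
  R) (x : R) :
    0 < alpha -> 0 < M -> 0 < C1 -> 0 < c ->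
    continuously_differentiable_pos gamma -> monotonic_pos gamma ->
    gamma t @[t --> 0^'+] --> (0 : R) ->
    (forall t : R, 0 < t -> C1 <= `|t * derive1 gamma t / gamma t|) ->
    (forall t : R, 0 < t -> c * t `^ M <= `|gamma t|) ->
    measurable_fun setT f ->
  (fractional_integral alpha gamma f x <=
    (c `^ (- (alpha / M)) / C1)%:E * riesz_potential (alpha / M) f x)%E.
Proof.
move=> a0 M0 C10 c0 [dg cg] mono g0 gC1 gc mf.
have [s [s1 _ nd]] := monotonic_pos_sign mono g0.
have ss : s * s = 1 by rewrite -expr2 -real_normK ?num_real// s1 expr1n.
have gn0 (t : R) : 0 < t -> 0 < `|gamma t|.
  by move=> t0; apply: lt_le_trans (gc t t0); rewrite mulr_gt0// powR_gt0.
pose w t := s * derive1 gamma t.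
have dsg (t : R) : 0 < t -> is_derive t 1 (fun u => s * gamma u) (w t).
  move=> t0; have gt : is_derive t 1 gamma (derive1 gamma t).
    by rewrite derive1E; apply: derivableP; exact: dg.
  by have := is_deriveZ s gt.
have w0 (t : R) : 0 < t -> 0 <= w t.
  move=> t0; have <- : derive1 (fun u => s * gamma u) t = w t.
    by have [_ <-] := dsg t t0; rewrite derive1E.
  by apply: nondecreasing_derive1_ge0 => // u /dsg[].
have wE (t : R) : 0 < t -> w t = `|derive1 gamma t|.
  by move=> t0; rewrite -(ger0_norm (w0 t t0)) /w normrM s1 mul1r.
have cw (t : R) : 0 < t -> {for t, continuous w}.
  by move=> t0; apply: continuousM; [exact: cvg_cst|exact: cg].
pose F (y : R) := (`|f y| * `|x - y| `^ (alpha / M - 1))%:E.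
have F0 y : (0 <= F y)%E by rewrite lee_fin mulr_ge0// powR_ge0.
have mF : measurable_fun setT F.
  apply/measurable_EFinP; apply: measurable_funM; first exact: measurableT_comp.
  apply: (measurableT_comp (measurable_powR _)); apply: measurableT_comp => //.
  exact: measurable_funB.
have dG (t : R) : 0 < t -> is_derive t 1 (fun t => x - gamma t) (- s * w t).
  move=> t0; rewrite /w mulNr mulrA ss mul1r.
  have gt : is_derive t 1 gamma (derive1 gamma t).
    by rewrite derive1E; apply: derivableP; exact: dg.
  by have := is_deriveB (is_derive_cst x t (1 : R)) gt; rewrite sub0r.
have Ns1 : `|- s| = 1 by rewrite normrN.
have cov := monotone_change_of_variables_le Ns1 dG w0 cw mF F0.
have K0 : 0 <= c `^ (- (alpha / M)) / C1 by rewrite divr_ge0 ?powR_ge0// ltW.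
apply: le_trans (lee_wpmul2l _ cov) => //.
have mFG : measurable_fun halfline (fun t => F (x - gamma t)%R * (w t)%:E)%E.
  have mw : measurable_fun halfline w.
    apply: open_continuous_measurable_fun; first exact: interval_open.
    by move=> t; rewrite inE/= in_itv/= andbT; exact: cw.
  have mg : measurable_fun halfline (fun t => x - gamma t).
    apply: open_continuous_measurable_fun; first exact: interval_open.
    move=> t; rewrite inE/= in_itv/= andbT => t0.
    apply/differentiable_continuous/derivable1_diffP.
    by have [] := dG t t0.
  by apply: emeasurable_funM; [exact: (measurableT_comp mF
    mg)|exact/measurable_EFinP].
rewrite -ge0_integralZl//; last first.
- by move=> t; rewrite /= in_itv/= andbT => t0; apply: mule_ge0;
    rewrite ?lee_fin ?w0.
apply: ge0_le_integral => //.
- by move=> t _; rewrite lee_fin divr_ge0// powR_ge0.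
- exact: measurable_fractional_integrand.
- by apply: emeasurable_funM => //; exact: measurable_cst.
move=> t; rewrite /= in_itv/= andbT => t0.
rewrite /F -!EFinM lee_fin subKr mulrCA -!mulrA ler_wpM2l//.
rewrite wE//.
have gt0 := gn0 t t0.
have H1 : t^-1 <= C1^-1 * (`|derive1 gamma t| / `|gamma t|).
  have := gC1 t t0; rewrite !normrM normfV (gtr0_norm t0) => H.
  by rewrite mulrC ler_pdivlMr// -(ler_pM2l t0) mulrA divff ?gt_eqF//
    mul1r mulrA.
have H2 : t `^ alpha <= c `^ (- (alpha / M)) * `|gamma t| `^ (alpha / M).
  have ct : t `^ M <= `|gamma t| / c by rewrite ler_pdivlMr// mulrC gc.
  have := ge0_ler_powR (ltW (divr_gt0 a0 M0)) (powR_ge0 t M) _ ct.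
  rewrite -powRrM mulrCA divff ?gt_eqF// mulr1 => H.
  apply: le_trans (H _) _; first by rewrite nnegrE divr_ge0// ltW.
  by rewrite powRM ?invr_ge0 ?(ltW c0)// mulrC -powR_inv1 ?(ltW c0)//
    -powRrM mulN1r.
have -> : (t `^ (1 - alpha))^-1 = t^-1 * t `^ alpha.
  rewrite -powRN opprB -powR_inv1 ?(ltW t0)// -powRD;
    last by rewrite (gt_eqF t0) implybT.
  by rewrite addrC.
apply: le_trans (ler_pM _ _ H1 H2) _; rewrite ?invr_ge0 ?(ltW t0) ?powR_ge0//.
have -> : `|gamma t| `^ (alpha / M - 1) = `|gamma t| `^ (alpha / M) / `|gamma
  t|.
  by rewrite powRB ?(gt_eqF gt0) ?implybT// powRr1.
by rewrite le_eqVlt; apply/orP; left; apply/eqP; ring.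
Qed.

End fractional.

(** * Boundedness and power lower bounds *)

Section main.
Context (R : realType).
Notation mu := (@lebesgue_measure R).

Lemma fractional_integral_bounded_power (alpha M C1 c p q : R) (gamma : R ->
  R) :
    0 < alpha -> 0 < C1 -> 0 < c ->
    continuously_differentiable_pos gamma -> monotonic_pos gamma ->
    gamma t @[t --> 0^'+] --> (0 : R) ->
    (forall t : R, 0 < t -> C1 <= `|t * derive1 gamma t / gamma t|) ->
    (forall t : R, 0 < t -> c * t `^ M <= `|gamma t|) ->
    1 < p -> p < q -> p^-1 - q^-1 = alpha / M ->
  fractional_integral_bounded alpha gamma p q.
Proof.
move=> a0 C10 c0 dg mono g0 gC1 gc p1 pq pqM.
have p0 : 0 < p by exact: lt_trans p1.
have q0 : 0 < q by exact: lt_trans pq.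
have M0 : 0 < M.
  have : 0 < alpha / M by rewrite -pqM subr_gt0 ltf_pV2.
  by rewrite pmulr_rgt0// invr_gt0.
have [C C0 hls] := hardy_littlewood_sobolev p1 pq.
pose K := c `^ (- (alpha / M)) / C1.
have K0 : 0 < K by rewrite divr_gt0// powR_gt0.
exists (K * C); first by rewrite mulr_gt0.
move=> f Lf; have mf : measurable_fun setT f by have [] :=
  Lfun_locally_integrable p1 Lf.
have dgamma := dg.1.
have R0 x : (0 <= riesz_potential (alpha / M) f x)%E.
  by apply: integral_ge0 => y _; rewrite lee_fin mulr_ge0// powR_ge0.
have mR := measurable_riesz_potential (alpha / M) mf.
apply: (@le_trans _ _ ('N[mu]_(q%:E)[(fun x =>
  K%:E * riesz_potential (alpha / M) f x)])%E).
  apply: le_Lnorm => //.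
  - exact: measurable_fractional_integral.
  - by apply: emeasurable_funM => //; exact: measurable_cst.
  - by move=> x; apply: integral_ge0 => t _;
      rewrite lee_fin divr_ge0// powR_ge0.
  - by move=> x; exact: fractional_integral_le_riesz.
rewrite LnormZ_ge0 ?(ltW K0)//
  [in leRHS]EFinM -muleA lee_wpmul2l ?lee_fin ?(ltW K0)//.
by rewrite -pqM; exact: hls.
Qed.

Lemma Lnorm_indic (r c : R) (A : set R) : 0 < r -> 0 <= c -> measurable A ->
  ('N[mu]_(r%:E)[(fun x => (c * \1_A x)%:E)] = c%:E * mu A `^ r^-1)%E.
Proof.
move=> r0 c0 mA.
have mI : measurable_fun setT (\1_A : R -> R) by exact: measurable_indic.
rewrite (_ : (fun x => _) = (fun x => c%:E * (\1_A x)%:E)%E); last first.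
  by apply/funext => x; rewrite EFinM.
have mI' : measurable_fun setT (fun x =>
  (\1_A x)%:E : \bar R) by exact/measurable_EFinP.
have I0 x : (0 <= (\1_A x : R)%:E)%E by rewrite lee_fin indicE ler0n.
rewrite (LnormZ_ge0 r0 c0 mI' I0).
congr (_ * _)%E; rewrite unlock; congr poweR.
rewrite -[X in mu X](setIT A) -integral_indic//; apply: eq_integral => x _.
by rewrite /= indicE; case: (x \in A);
  rewrite ?normr1 ?normr0 ?powR1 ?powR0 ?gt_eqF.
Qed.

Lemma Lfun_indic (r : R) (A : set R) : 0 < r -> measurable A ->
  (mu A < +oo)%E ->
  \1_A \in Lfun mu r%:E.
Proof.
move=> r0 mA muA; rewrite inE; apply/andP; split; rewrite inE/=.
  exact: measurable_indic.
rewrite /finite_norm (_ : EFin \o \1_A = (fun x => (1 * \1_A x)%:E)).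
  by rewrite Lnorm_indic// mul1e poweR_lty.
by apply/funext => x; rewrite mul1r.
Qed.

Lemma itv_symmetric_measure (a : R) : 0 <= a -> mu `[- a, a] = (2 * a)%:E.
Proof.
move=> a0; rewrite lebesgue_measure_itv/= lte_fin; case: ltP => [_|aa].
  by rewrite -EFinB opprK mulr2n mulrDl mul1r.
by congr (_%:E); lra.
Qed.

(** Test on the indicator [f] of [B = [-2 g, 2 g]] with [g = |gamma t|]. For [x]
    in [A = [-g, g]] and [u <= t] the point [x - gamma u] is in [B]; keeping
    only [u] between [t / 2] and [t], where the kernel is at least
    [t^(alpha - 1)], bounds the operator below by [t^alpha / 2] on [A]. *)
Lemma bounded_power_lower_bound (alpha p q : R) (gamma : R -> R) :
    alpha < 1 -> 1 < p -> p < q ->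
    (forall t : R, 0 < t -> derivable gamma t 1) ->
    (forall t : R, 0 < t -> gamma t != 0) ->
    (forall t u : R, 0 < t -> t <= u -> `|gamma t| <= `|gamma u|) ->
    fractional_integral_bounded alpha gamma p q ->
  exists2 c : R, 0 < c &
    forall t : R, 0 < t -> c * t `^ alpha <= `|gamma t| `^ (p^-1 - q^-1).
Proof.
move=> a1 p1 pq dg gn0 nd [C C0 bdd].
have p0 : 0 < p by exact: lt_trans p1.
have q0 : 0 < q by exact: lt_trans pq.
(* The norms of the indicators of A and B below involve mu A = 2 g and
   mu B = 4 g; D collects the resulting constants. *)
pose D := C * 4 `^ p^-1 * 2 / 2 `^ q^-1.
have D0 : 0 < D by rewrite divr_gt0 ?mulr_gt0 ?powR_gt0.
exists D^-1; first by rewrite invr_gt0.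
move=> t t0; set g := `|gamma t|.
have g0 : 0 < g by rewrite normr_gt0 gn0.
pose B : set R := `[- (2 * g), 2 * g]%classic.
pose A : set R := `[- g, g]%classic.
have mB : measurable B by exact: measurable_itv.
have mA : measurable A by exact: measurable_itv.
pose f : R -> R := \1_B.
have mf : measurable_fun setT f by exact: measurable_indic.
have muB : mu B = (2 * (2 * g))%:E.
  by rewrite itv_symmetric_measure// mulr_ge0// ltW.
have Lf : f \in Lfun mu p%:E.
  by apply: Lfun_indic => //; rewrite [ltLHS]muB ltry.
have Nf : ('N[mu]_(p%:E)[EFin \o f])%E = ((4 * g) `^ p^-1)%:E.
  rewrite (_ : EFin \o f = (fun x => (1 * f x)%:E)); last first.
    by apply/funext => x; rewrite mul1r.
  rewrite Lnorm_indic// mul1e muB poweR_EFin; congr ((_ `^ _)%:E); lra.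
have If (x : R) : ((t `^ alpha / 2 * \1_A x)%:E
    <= fractional_integral alpha gamma f x)%E.
  rewrite indicE; have [|_] := boolP (x \in A); last first.
    by rewrite mulr0; apply: integral_ge0 => u _;
      rewrite lee_fin divr_ge0// powR_ge0.
  rewrite inE /A/= in_itv/= => /andP[gx xg]; rewrite mulr1.
  rewrite (_ : t `^ alpha / 2 = t `^ (alpha - 1) * (t - t / 2)); last first.
    have -> : t - t / 2 = t / 2 by lra.
    by rewrite mulrA powRB1_mulr.
  apply: integral_halfline_ge; rewrite ?powR_ge0//.
  - by rewrite divr_gt0.
  - by lra.
  - exact: measurable_fractional_integrand.
  - by move=> u u0; rewrite lee_fin divr_ge0// powR_ge0.
  move=> u /andP[tu ut]; have u0 : 0 < u by apply: lt_le_trans tu;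
    rewrite divr_gt0.
  have gu : `|gamma u| <= g by exact: nd.
  rewrite lee_fin /f indicE mem_set/=; last first.
    by rewrite /B/= in_itv/=; move: gu; rewrite ler_norml => /andP[? ?];
      apply/andP; split; lra.
  rewrite normr1 mul1r -(opprB 1 alpha) powRN.
  rewrite lef_pV2 ?posrE ?powR_gt0// ge0_ler_powR ?nnegrE ?subr_ge0//;
    exact: ltW.
have ta0 : 0 <= t `^ alpha / 2 by rewrite divr_ge0 ?powR_ge0.
have muA : mu A = (2 * g)%:E by rewrite itv_symmetric_measure// ltW.
have : ((t `^ alpha / 2 * (2 * g) `^ q^-1)%:E <= (C * (4 * g) `^ p^-1)%:E)%E.
  rewrite [leRHS]EFinM -Nf; apply: le_trans (bdd f Lf).
  rewrite EFinM -poweR_EFin -muA -Lnorm_indic//.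
  apply: le_Lnorm => //.
  - apply/measurable_EFinP; apply: measurable_funM => //;
      exact: measurable_indic.
  - exact: measurable_fractional_integral.
  - by move=> x; rewrite lee_fin mulr_ge0// indicE ler0n.
rewrite lee_fin !powRM ?(ltW g0)// => H.
rewrite powRB ?(gt_eqF g0) ?implybT//.
rewrite ler_pdivlMr ?powR_gt0// /D invf_div.
have A0 : 0 < C * 4 `^ p^-1 * 2 by rewrite !mulr_gt0 ?powR_gt0.
rewrite -!mulrA -(ler_pM2l A0).
have E1 : C * 4 `^ p^-1 * 2 * (2 `^ q^-1 * ((C * (4 `^ p^-1 * 2))^-1 * (t `^
  alpha * g `^ q^-1)))
  = 2 * (t `^ alpha / 2 * (2 `^ q^-1 * g `^ q^-1)).
  by field; rewrite !gt_eqF ?powR_gt0.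
rewrite E1 (_ : _ * g `^ p^-1 = 2 * (C * (4 `^ p^-1 * g `^ p^-1)));
  last by ring.
by rewrite ler_pM2l.
Qed.

End main.

Section indices.
Context (R : realType).
Variables (gamma : R -> R) (N c : R).
Hypotheses (gamma_neq0 : forall t : R, 0 < t -> gamma t != 0) (c_gt0 : 0 < c).
Hypothesis gamma_ge : forall t : R, 0 < t -> c * t `^ N <= `|gamma t|.

Let ln_gamma_ge (t : R) : 0 < t -> ln c + N * ln t <= ln `|gamma t|.
Proof.
move=> t0; rewrite -ln_powR -lnM ?posrE ?powR_gt0// ler_ln ?posrE ?gamma_ge//.
  by rewrite mulr_gt0 ?powR_gt0.
by rewrite normr_gt0 gamma_neq0.
Qed.

(** Dividing [ln c + N ln t <= ln |gamma t|] by [ln t < 0] reverses it, and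
    [ln c / ln t] tends to [0]. *)
Lemma omega01_le_power : (omega01 gamma <= N%:E)%E.
Proof.
rewrite /omega01 limf_einfE; apply: ge_ereal_sup => _ [V V0 <-].
apply/lee_addgt0Pr => e e0; have [d /= d0 dV] := V0.
pose t := Num.min (d / 2) (expR (- (`|ln c| / e) - 1)).
have t0 : 0 < t by rewrite lt_min divr_gt0// expR_gt0.
have Vt : V t.
  apply: dV => //=; rewrite sub0r normrN gtr0_norm//.
  by rewrite gt_min; apply/orP; left; lra.
have lnt : ln t <= - (`|ln c| / e) - 1.
  by rewrite -[leRHS]expRK ler_ln ?posrE ?expR_gt0// ge_min lexx orbT.
have lnt0 : ln t < 0.
  apply: le_lt_trans lnt _; have : 0 <= `|ln c| / e by rewrite divr_ge0// ltW.
  by lra.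
apply: (@le_trans _ _ (log_ratio gamma t)).
  by apply: ereal_inf_lbound; exists t.
rewrite /log_ratio -EFinD lee_fin ler_ndivrMr//.
apply: le_trans (ln_gamma_ge t0).
rewrite mulrDl addrC lerD2r.
have : e * ln t <= e * (- (`|ln c| / e) - 1) by rewrite ler_pM2l.
have -> : e * (- (`|ln c| / e) - 1) = - `|ln c| - e by field; rewrite gt_eqF.
have := ler_norm (- ln c); rewrite normrN; lra.
Qed.

(** The same logarithmic inequality, now divided by [ln t > 0]. *)
Lemma power_le_omegaoo2 : (N%:E <= omegaoo2 gamma)%E.
Proof.
rewrite /omegaoo2 limf_esupE; apply: le_ereal_inf_tmp => _ [W Woo <-].
apply/lee_addgt0Pr => e e0; have [A [_ AW]] := Woo.
pose t := Num.max (A + 1) (expR (`|ln c| / e + 1)).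
have t0 : 0 < t by rewrite lt_max expR_gt0 orbT.
have Wt : W t by apply: AW; rewrite lt_max ltrDl ltr01.
have lnt : `|ln c| / e + 1 <= ln t.
  by rewrite -[leLHS]expRK ler_ln ?posrE ?expR_gt0// le_max lexx orbT.
have lnt0 : 0 < ln t.
  apply: lt_le_trans lnt; have : 0 <= `|ln c| / e by rewrite divr_ge0// ltW.
  by lra.
apply: (@le_trans _ _ (log_ratio gamma t + e%:E)%E); last first.
  by rewrite leeD2r//; apply: ereal_sup_ubound; exists t.
rewrite /log_ratio -EFinD lee_fin -lerBlDr ler_pdivlMr//.
apply: le_trans (ln_gamma_ge t0).
rewrite mulrBl addrC lerD2r.
have : e * (`|ln c| / e + 1) <= e * ln t by rewrite ler_pM2l.
have -> : e * (`|ln c| / e + 1) = `|ln c| + e by field; rewrite gt_eqF.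
have := ler_norm (- ln c); rewrite normrN; lra.
Qed.

End indices.

Unset Implicit Arguments.

Theorem lemma2p2 (R : realType) (alpha : R) (gamma : R -> R)
    (alpha_gt0 : 0 < alpha) (alpha_lt1 : alpha < 1)
    (gamma_C1 : continuously_differentiable_pos gamma)
    (gamma_mono : monotonic_pos gamma)
    (gamma_0 : gamma t @[t --> 0^'+] --> (0 : R))
    (gamma_growth : exists C1 C2 : R, [/\ 0 < C1, 0 < C2 &
       forall t : R, 0 < t ->
         C1 <= `|t * derive1 gamma t / gamma t| <= C2])
    (omega_le : (omega02 gamma <= omegaoo1 gamma)%E) :
  (forall p q : R, 1 < p -> p < q ->
     (exists M : R, (omega02 gamma < M%:E < omegaoo1 gamma)%E /\
        p^-1 - q^-1 = alpha / M) ->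
     fractional_integral_bounded alpha gamma p q) /\
  (forall p q : R, 1 < p -> p < q ->
     fractional_integral_bounded alpha gamma p q ->
     exists N : R, (omega01 gamma <= N%:E <= omegaoo2 gamma)%E /\
        p^-1 - q^-1 = alpha / N).
Proof.
have [C1 [C2 [C10 _ growth]]] := gamma_growth.
have gC1 (t : R) : 0 < t -> C1 <= `|t * derive1 gamma t / gamma t|.
  by move=> /growth/andP[].
have gn0 (t : R) : 0 < t -> gamma t != 0.
  move=> t0; apply/negP => /eqP gt0.
  by have := gC1 t t0; rewrite gt0 invr0 mulr0 normr0 leNgt C10.
have [s [_ sE nds]] := monotonic_pos_sign gamma_mono gamma_0.
have nd (t u : R) : 0 < t -> t <= u -> `|gamma t| <= `|gamma u|.
  by move=> t0 tu; rewrite -!sE ?(lt_le_trans t0)//; exact: nds.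
have pq_gt0 (p q : R) : 1 < p -> p < q -> 0 < p^-1 - q^-1.
  move=> p1 pq; have p0 : 0 < p by exact: lt_trans p1.
  by rewrite subr_gt0 ltf_pV2// posrE (lt_trans p0).
split=> p q p1 pq.
  move=> [M [/andP[wM Mw] pqM]].
  have M0 : 0 < M.
    by have := pq_gt0 p q p1 pq; rewrite pqM pmulr_rgt0// invr_gt0.
  have [c c0 gc] := power_lower_bound gn0 nd M0 wM Mw.
  exact: (fractional_integral_bounded_power alpha_gt0 C10 c0 gamma_C1 gamma_mono
    gamma_0 gC1 gc p1 pq pqM).
move=> bdd; have d0 := pq_gt0 p q p1 pq.
set d := p^-1 - q^-1 in d0 *.
have [c c0 gc] := bounded_power_lower_bound alpha_lt1 p1 pq gamma_C1.1 gn0 nd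
  bdd.
have gN (t : R) : 0 < t -> c `^ d^-1 * t `^ (alpha / d) <= `|gamma t|.
  move=> t0; rewrite powRrM -powRM ?powR_ge0 ?(ltW c0)//.
  rewrite -[leRHS](@invK_powR _ d) ?gt_eqF//.
  by rewrite ge0_ler_powR ?nnegrE ?mulr_ge0 ?powR_ge0 ?invr_ge0 ?(ltW c0) ?(ltW
    d0) ?gc.
have cd0 : 0 < c `^ d^-1 by exact: powR_gt0.
exists (alpha / d); split; last by field; rewrite !gt_eqF.
apply/andP; split; first exact: omega01_le_power gn0 cd0 gN.
exact: power_le_omegaoo2 gn0 cd0 gN.
Qed.
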